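(* Let $I \subset R = k[x_0,\ldots,x_n]$ be a homogeneous perfect ideal of codimension two with graded minimal free resolution $0 \to F \xrightarrow{\varphi} G \to I \to 0$. Let $m$ be a positive integer and assume that $I$ is a local complete intersection and that $\min\{\mathrm{rk}\, G - 1,\ m\} \leq n$. Then the canonical surjection $\mathrm{Sym}^m I \to I^m$ is an isomorphism, and the complex \[0 \to \textstyle\bigwedge^m F \to \bigwedge^{m-1} F \otimes \mathrm{Sym}^1 G \to \cdots \to F \otimes \mathrm{Sym}^{m-1} G \to \mathrm{Sym}^m G \to I^m \to 0\] (with maps as described in the context) is a graded minimal free resolution of $I^m$.
   Context: $R = k[x_0,\ldots,x_n]$ with $k$ an algebraically closed field of characteristic zero, $\mathfrak{m} = (x_0,\ldots,x_n)$. A homogeneous ideal $I$ is perfect (Cohen–Macaulay) if $\operatorname{depth}(R/I) = \dim(R/I)$. $I$ is a local complete intersection if for every prime $\mathfrak{p} \neq \mathfrak{m}$ with $I \subseteq \mathfrak{p}$, $I_{\mathfrak{p}}$ is a complete intersection of codimension equal to the height of $I$. The complex: let $G$ have homogeneous basis $e_1,\dots,e_r$ with $e_i \mapsto f_i$ (minimal generators of $I$), identify $\mathrm{Sym}\,G = R[t_1,\ldots,t_r]$ with $t_i = e_i$, and let $F$ have basis $u_1,\dots,u_s$ with $\varphi(u_j) = c_j := \sum_i \varphi_{ij} t_i \in \mathrm{Sym}^1 G$. The differential $\bigwedge^i F \otimes \mathrm{Sym}^{m-i} G \to \bigwedge^{i-1} F \otimes \mathrm{Sym}^{m-i+1} G$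 sends $(u_{j_1} \wedge \cdots \wedge u_{j_i}) \otimes g$ to $\sum_{l=1}^i (-1)^{l+1} (u_{j_1} \wedge \cdots \widehat{u_{j_l}} \cdots \wedge u_{j_i}) \otimes c_{j_l} g$ (the degree-$m$ strand in the $t$-variables of the Koszul complex on $c_1,\ldots,c_s$ over $\mathrm{Sym}\,G$), and $\mathrm{Sym}^m G \to I^m$ sends $t_1^{a_1}\cdots t_r^{a_r}$ to $f_1^{a_1}\cdots f_r^{a_r}$. All modules carry the induced gradings. *)

(* Defs.v *)
From HB Require Import structures.
From mathcomp Require Import all_boot all_order all_algebra.
From mathcomp Require Import mpoly.
Set Implicit Arguments. Unset Strict Implicit. Unset Printing Implicit Defensive.
Import Order.TTheory GRing.Theory.
Local Open Scope ring_scope.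

Section CommAlg.
Variables (n : nat) (k : closedFieldType).
Local Notation R := {mpoly k[n.+1]}.

Definition is_ideal (P : R -> Prop) :=
  [/\ P 0, (forall x y, P x -> P y -> P (x + y)) & (forall a x, P x -> P (a * x))].

Definition is_prime (P : R -> Prop) :=
  [/\ is_ideal P, ~ P 1 & (forall x y, P (x * y) -> P x \/ P y)].

Definition subI (P Q : R -> Prop) := forall x, P x -> Q x.

Definition maxm (x : R) : Prop := x@_0%MM = 0.

Definition ideal_of (gs : seq R) (x : R) : Prop :=
  exists cs : seq R, x = \sum_(i < size gs) cs`_i * gs`_i.

Definition ideal_mul (P Q : R -> Prop) (x : R) : Prop :=
  exists (N : nat) (a b : 'I_N -> R),
    (forall l, P (a l)) /\ (forall l, Q (b l)) /\ x = \sum_(l < N) a l * b l.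

Fixpoint ideal_pow (P : R -> Prop) (m : nat) : R -> Prop :=
  match m with
  | 0 => fun _ => True
  | m'.+1 => ideal_mul P (ideal_pow P m')
  end.

Definition prime_chain (l : nat) (P : nat -> R -> Prop) :=
  (forall i, (i <= l)%N -> is_prime (P i)) /\
  (forall i, (i < l)%N -> subI (P i) (P i.+1) /\ exists x, P i.+1 x /\ ~ P i x).

Definition dim_quot_ge (I : R -> Prop) (d : nat) :=
  exists P, prime_chain d P /\ subI I (P 0).
Definition dim_quot (I : R -> Prop) (d : nat) :=
  dim_quot_ge I d /\ ~ dim_quot_ge I d.+1.

Definition height_ge (p : R -> Prop) (h : nat) :=
  exists P, prime_chain h P /\ (forall x, P h x <-> p x).
Definition ideal_height (I : R -> Prop) (h : nat) :=
  (forall p, is_prime p -> subI I p -> height_ge p h) /\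
  (exists p, is_prime p /\ subI I p /\ ~ height_ge p h.+1).

Definition ideal_add (I : R -> Prop) (gs : seq R) (x : R) :=
  exists y z, I y /\ ideal_of gs z /\ x = y + z.

Definition quot_regular_seq (I : R -> Prop) (gs : seq R) :=
  (forall g, g \in gs -> maxm g) /\
  (forall i, (i < size gs)%N -> forall x,
      ideal_add I (take i gs) (gs`_i * x) -> ideal_add I (take i gs) x) /\
  ~ ideal_add I gs 1.

Definition depth_quot_ge (I : R -> Prop) (d : nat) :=
  exists gs, size gs = d /\ quot_regular_seq I gs.
Definition depth_quot (I : R -> Prop) (d : nat) :=
  depth_quot_ge I d /\ ~ depth_quot_ge I d.+1.

Definition perfect (I : R -> Prop) :=
  exists d, dim_quot I d /\ depth_quot I d.

(** Localization at a prime p: x lies in J R_p (J an ideal of R) *)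
Definition in_loc (p : R -> Prop) (J : R -> Prop) (x : R) :=
  exists s, ~ p s /\ J (s * x).

(* I_p is a complete intersection of codimension h: I R_p is generated by an
   R_p-regular sequence of length h (numerators taken in R, which loses nothing
   since denominators are units of R_p). *)
Definition complete_intersection_at (I : R -> Prop) (p : R -> Prop) (h : nat) :=
  exists gs : seq R, size gs = h /\
    (forall g, g \in gs -> in_loc p I g) /\
    (forall x, I x -> in_loc p (ideal_of gs) x) /\
    (forall i, (i < size gs)%N -> forall x,
        in_loc p (ideal_of (take i gs)) (gs`_i * x) ->
        in_loc p (ideal_of (take i gs)) x) /\
    ~ in_loc p (ideal_of gs) 1.

Definition local_complete_intersection (I : R -> Prop) :=
  forall h, ideal_height I h ->
  forall p, is_prime p -> subI I p -> ~ (forall x, p x <-> maxm x) ->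
    complete_intersection_at I p h.

End CommAlg.

(** The Koszul-type complex.  Sym G = R[t_1..t_r] = {mpoly R[r]};
    an element of  /\^i F (x) Sym^{m-i} G  is a finite function
    w : {set 'I_s} -> Sym G, supported on i-subsets J, with w J of t-degree m-i
    (w J is the coefficient of u_J = u_{j_1} /\ ... /\ u_{j_i}, j_1 < ... < j_i). *)
Section Koszul.
Variables (n : nat) (k : closedFieldType) (r s : nat).
Local Notation R := {mpoly k[n.+1]}.
Local Notation SG := {mpoly R[r]}.
Variable phi : 'M[R]_(r, s).

Definition cvec (j : 'I_s) : SG := \sum_(i < r) phi i j *: 'X_i.

(* the differential: (u_J (x) g) |-> sum_l (-1)^(l+1) u_{J \ j_l} (x) c_{j_l} g *)
Definition kdiff (w : {ffun {set 'I_s} -> SG}) : {ffun {set 'I_s} -> SG} :=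
  [ffun K : {set 'I_s} => \sum_(j < s | j \notin K)
                (-1) ^+ #|[set x in K | (x < j)%N]| * cvec j * w (j |: K)].

Definition inC (m i : nat) (w : {ffun {set 'I_s} -> SG}) :=
  forall J : {set 'I_s}, (#|J| != i -> w J = 0) /\ w J \is (m - i).-homog.

Definition evalf (f : 'I_r -> R) (P : SG) : R := P.@[f].

End Koszul.

(* Main.v *)
Require Import Defs.
From HB Require Import structures.
From mathcomp Require Import all_boot all_order all_algebra.
From mathcomp Require Import mpoly ring zify.
From mathcomp Require boolp classical_sets.
Set Implicit Arguments. Unset Strict Implicit. Unset Printing Implicit Defensive.
Import GRing.Theory.
Local Open Scope ring_scope.

(** By the acyclicity lemma of Peskine and Szpiro, a complex of free modules
    over [k[x_0, ..., x_n]] of length at most [n + 1] is exact as soon as its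
    homology is killed by powers of the variables.  The strand of degree [m],
    augmented by [R] through [t_i |-> f_i], has length [min (rk G - 1) m + 1],
    so it is enough to find, for every cycle and every prime [p] other than the
    irrelevant ideal, a multiplier outside [p] that turns it into a boundary.

    At such a [p] the ideal [I] has at most two generators, so [phi] modulo [p]
    has rank at least [s - 1]: all the [c_j] but one are part of a coordinate
    system of [R_p[t]].  Hence the [c_j], suitably ordered, form a regular
    sequence and their Koszul complex is exact.  The powers of [I] kill the
    kernel of [Sym^m I -> I^m], and [Sym^m I] has no [I_p]-torsion because
    [R_p[t] / (c)] is a hypersurface in a polynomial ring over [R_p] while
    [I_p] contains a regular sequence of length two. *)

(** Nothing is localized: a statement at [p] is a statement over [R] up to a multiplier [a] with
    [pi a != 0], where [pi] is the map to the residue field. The module [I^m] is not free, so it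
    cannot be a term of the complex; the augmentation by [R] keeps all terms free, and exactness is
    claimed only from index one on, which leaves the last homology [R / I^m] alone. The rank of
    [phi] modulo [p] is bounded without Fitting ideals. If [t f = U V f] with [q] rows in [V], the
    rows of [t Id - U V] are syzygies, hence combinations of the columns of [phi], so
    [r <= q + rank]. With [q <= 2] and [s < r] this gives rank at least [s - 1]. Powers of [I] kill
    the kernel because [f_i t_j - f_j t_i] comes from a syzygy and so lies in [(c)]: modulo [(c)],
    [f_i^m P] equals [P(f) t_i^m] for every form [P] of degree [m]. Once [s - 1] of the [c_j] are
    eliminated, injectivity of [phi] makes the last one nonzero in a domain; this gives both its
    regularity and the hypersurface. *)

Section ResidueField.
Variables (A : comNzRingType) (P : A -> Prop).
Hypothesis P0 : P 0.
Hypothesis PD : forall x y, P x -> P y -> P (x + y).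
Hypothesis PM : forall a x, P x -> P (a * x).
Hypothesis P1 : ~ P 1.
Hypothesis Pprime : forall x y, P (x * y) -> P x \/ P y.

Let Pb : {pred A} := fun x => boolp.asbool (P x).

Fact asbool_idealr_closed : idealr_closed Pb.
Proof.
split; rewrite ?unfold_in /Pb.
- exact/boolp.asboolP.
- exact/boolp.asboolPn.
- move=> a x y; rewrite !unfold_in => /boolp.asboolP Px /boolp.asboolP Py.
  by apply/boolp.asboolP/PD => //; apply: PM.
Qed.

Fact asbool_prime_idealr_closed : prime_idealr_closed Pb.
Proof.
move=> x y; rewrite !unfold_in => /boolp.asboolP /Pprime [Px|Py]; apply/orP;
  [left|right]; exact/boolp.asboolP.
Qed.

HB.instance Definition _ := isIdealr.Build A Pb asbool_idealr_closed.
HB.instance Definition _ :=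
  isPrimeIdealrClosed.Build A Pb asbool_prime_idealr_closed.

Let primeP : prime_idealr A := HB.pack Pb.

Definition residue_domain := {ideal_quot primeP}.
HB.instance Definition _ := GRing.ComNzRing.on residue_domain.

(** Fraction fields are taken of an [idomainType], so the quotient must carry a unit predicate and
    an inverse; both are chosen classically. *)
Let qunit : pred residue_domain :=
  fun x => boolp.asbool (exists y, y * x = 1).
Let qinv (x : residue_domain) : residue_domain :=
  if boolp.pselect (exists y, y * x = 1) is left e
  then projT1 (boolp.cid e) else x.

Fact qmulVr : {in qunit, left_inverse 1 qinv *%R}.
Proof.
move=> x /boolp.asboolP ux; rewrite /qinv.
by case: boolp.pselect => // e; case: boolp.cid.
Qed.

Fact qunitPl x y : y * x = 1 -> qunit x.
Proof. by move=> yx; apply/boolp.asboolP; exists y. Qed.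

Fact qinv_out : {in [predC qunit], qinv =1 id}.
Proof.
by move=> x /boolp.asboolPn ux; rewrite /qinv; case: boolp.pselect.
Qed.

HB.instance Definition _ := GRing.ComNzRing_hasMulInverse.Build residue_domain
  qmulVr qunitPl qinv_out.
HB.instance Definition _ := GRing.ComUnitRing_isIntegral.Build residue_domain
  (@Quotient.rquot_IdomainAxiom A primeP).

Local Open Scope quotient_scope.

Lemma residue_field : exists (F : fieldType) (p : {rmorphism A -> F}),
  forall x, p x = 0 <-> P x.
Proof.
pose pr : {rmorphism A -> residue_domain} := \pi_{ideal_quot primeP}.
exists {fraction residue_domain}, (@tofrac residue_domain \o pr) => x /=.
have prE : pr x = 0 <-> P x.
  have -> : (pr x = 0) <-> x - 0 \in Pb.
    by rewrite (Quotient.idealrBE primeP) -(rmorph0 pr); split=> /eqP.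
  by rewrite subr0 unfold_in; split => /boolp.asboolP.
rewrite -prE -(@tofrac0 residue_domain).
by split=> [/eqP|->]; [rewrite tofrac_eq => /eqP|].
Qed.
End ResidueField.

(** * Primes avoiding the powers of an element *)

Section PrimeAvoidance.
Variables (n : nat) (k : closedFieldType).
Local Notation R := {mpoly k[n.+1]}.

Lemma prime_avoiding_powers (J : R -> Prop) (x : R) :
  is_ideal J -> (forall e, ~ J (x ^+ e)) ->
  exists p, [/\ is_prime p, subI J p & ~ p x].
Proof.
move=> [J0 JD JM] Jx.
pose good (q : R -> Prop) := [/\ is_ideal q, subI J q & forall e, ~ q (x ^+ e)].
have goodJ : good J by split.
have [F FP totF|p [[p0|[[p0 pD pM] Jp px]] maxp]] :=
    @classical_sets.Zorn_bigcup R (fun q => (forall y, ~ q y) \/ good q).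
- have [[q [Fq gq]]|nF] := boolp.pselect (exists q, F q /\ good q); last first.
    left=> y [q Fq qy]; case: (FP q Fq) => [/(_ y)//|gq].
    by apply: nF; exists q.
  right; case: (gq) => -[q0 _ _] Jq _; split.
  + split; first by exists q.
    * move=> y z [q1 Fq1 q1y] [q2 Fq2 q2z].
      have [h|h] := totF _ _ Fq1 Fq2.
        exists q2 => //; case: (FP q2 Fq2) => [/(_ _ q2z)//|[[_ D _] _ _]].
        by apply: D => //; apply: h.
      exists q1 => //; case: (FP q1 Fq1) => [/(_ _ q1y)//|[[_ D _] _ _]].
      by apply: D => //; apply: h.
    * move=> a y [q1 Fq1 q1y]; exists q1 => //.
      by case: (FP q1 Fq1) => [/(_ _ q1y)//|[[_ _ M] _ _]]; apply: M.
  + by move=> y Jy; exists q => //; apply: Jq.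
  + move=> e [q1 Fq1 q1x].
    by case: (FP q1 Fq1) => [/(_ _ q1x)//|[_ _ /(_ _ q1x)]].
- exfalso; apply: (maxp J); last by right.
  by split=> [y /p0//|/(_ 0) H]; apply: (p0 0); apply: H.
(* By maximality [p + (y)] contains a power of [x]; the product of two such expressions shows that
   [p] is prime. *)
have meet y : ~ p y -> exists e a z, p z /\ x ^+ e = a * y + z.
  move=> py; apply: boolp.contrapT => nmeet.
  apply: (maxp (fun w => exists a z, p z /\ w = a * y + z)); last first.
    right; split.
    - split.
      + by exists 0, 0; rewrite mul0r add0r.
      + move=> _ _ [a [z [pz ->]]] [b [w [pw ->]]].
        by exists (a + b), (z + w); split; [exact: pD | ring].
      + move=> b _ [a [z [pz ->]]].
        by exists (b * a), (b * z); split; [exact: pM | ring].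
    - by move=> w Jw; exists 0, w; rewrite mul0r add0r; split=> //; apply: Jp.
    - by move=> e [a [z [pz xe]]]; apply: nmeet; exists e, a, z.
  split; first by move=> w pw; exists 0, w; rewrite mul0r add0r.
  by move=> /(_ y) H; apply/py/H; exists 1, 0; rewrite mul1r addr0.
exists p; split=> //; last by move=> H; apply: (px 1); rewrite expr1.
split=> //; first by move=> H; apply: (px 0); rewrite expr0.
move=> y z pyz; apply: boolp.contrapT => /boolp.not_orP[].
move=> /meet[e1 [a1 [z1 [pz1 E1]]]] /meet[e2 [a2 [z2 [pz2 E2]]]].
apply: (px (e1 + e2)%N); rewrite exprD E1 E2.
have -> : (a1 * y + z1) * (a2 * z + z2) =
  (a1 * a2) * (y * z) + ((a1 * y + z1) * z2 + (a2 * z) * z1) by ring.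
by apply: (pD _ _ (pM _ _ pyz)); apply: pD; apply: pM.
Qed.
End PrimeAvoidance.

(** * The acyclicity lemma, in terms of elements *)

Section Acyclicity.
Variables (A : comNzRingType) (E : lmodType A) (q : nat) (x : nat -> A).
Variables (d : nat -> E -> E) (C : nat -> E -> Prop).

(* The submodule [(x_0, ..., x_(l-1)) C_i].  The acyclicity lemma is proved by
   descending induction on [l] for congruences modulo these submodules, which
   avoids forming the quotient complexes. *)
Fixpoint first_multiples (l i : nat) (w : E) : Prop :=
  if l is l'.+1 then
    exists u v, [/\ C i u, first_multiples l' i v & w = x l' *: u + v]
  else w = 0.
Local Notation D := first_multiples.

Hypothesis C0 : forall i, C i 0.
Hypothesis CP : forall i a u v, C i u -> C i v -> C i (a *: u + v).
Hypothesis dP : forall i a u v, d i (a *: u + v) = a *: d i u + d i v.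
Hypothesis dC : forall i w, C i.+1 w -> C i (d i w).
Hypothesis dd : forall i w, C i.+2 w -> d i (d i.+1 w) = 0.
Hypothesis Cbounded : forall i w, (q < i)%N -> C i w -> w = 0.
Hypothesis Cregular : forall l i u,
  (l < q)%N -> C i u -> D l i (x l *: u) -> D l i u.
Hypothesis torsion : forall i z j, C i.+1 z -> d i z = 0 -> (j < q)%N ->
  exists e u, C i.+2 u /\ x j ^+ e *: z = d i.+1 u.

Let d0 i : d i 0 = 0.
Proof. by have := dP i (-1) 0 0; rewrite !scaleN1r oppr0 addr0 addNr. Qed.

Let dZ i a u : d i (a *: u) = a *: d i u.
Proof. by rewrite -[a *: u]addr0 dP d0 !addr0. Qed.

Let dB i u v : d i (u - v) = d i u - d i v.
Proof. by rewrite [u - v]addrC -scaleN1r dP scaleN1r addrC. Qed.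

Let CZ i a u : C i u -> C i (a *: u).
Proof. by move=> Cu; rewrite -[_ *: _]addr0; apply: CP. Qed.

Let CD i u v : C i u -> C i v -> C i (u + v).
Proof. by rewrite -{2}[u]scale1r; apply: CP. Qed.

Let CB i u v : C i u -> C i v -> C i (u - v).
Proof. by move=> Cu Cv; rewrite addrC -scaleN1r; apply: CP. Qed.

Let D0 l i : D l i 0.
Proof.
elim: l => //= l IH; exists 0, 0; split=> //.
by rewrite scaler0 addr0.
Qed.

Let DP l i a u v : D l i u -> D l i v -> D l i (a *: u + v).
Proof.
elim: l u v => [u v -> ->|l IH _ _ [u1 [u2 [Cu1 Du2 ->]]] [v1 [v2 [Cv1 Dv2 ->]]]].
  by rewrite scaler0 addr0.
exists (a *: u1 + v1), (a *: u2 + v2); split; [exact: CP|exact: IH|].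
by rewrite !scalerDr !scalerA mulrC addrACA.
Qed.

Let DZ l i a u : D l i u -> D l i (a *: u).
Proof. by move=> Du; rewrite -[_ *: _]addr0; apply: DP. Qed.

Let DD l i u v : D l i u -> D l i v -> D l i (u + v).
Proof. by rewrite -{2}[u]scale1r; apply: DP. Qed.

Let DB l i u v : D l i u -> D l i v -> D l i (u - v).
Proof. by move=> Du Dv; rewrite addrC -scaleN1r; apply: DP. Qed.

Let Dd l i w : D l i.+1 w -> D l i (d i w).
Proof.
elim: l w => [w ->|l IH _ [u [v [Cu Dv ->]]]]; first exact: d0.
by exists (d i u), (d i v); rewrite dP; split; [exact: dC|exact: IH|].
Qed.

(** The connecting map for multiplication by [x l]. If [d z = x l u + v], regularity makes [u] a
    cycle modulo [D l]; a power of [x j] makes it the boundary of some [u'] modulo [D l], and then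
    [x j ^+ e *: z - x l *: u'] is a cycle modulo [D l], to which the induction applies again. Each
    element divided out costs one index, whence [l <= i]. *)
Let torsion_mod l i z j :
  (l <= i)%N -> (l <= q)%N -> C i.+1 z -> D l i (d i z) -> (j < q)%N ->
  exists e u, C i.+2 u /\ D l i.+1 (x j ^+ e *: z - d i.+1 u).
Proof.
elim: l i z => [|l IH] i z li lq Cz Dz jq.
  have [e [u [Cu E1]]] := torsion Cz Dz jq.
  by exists e, u; split=> //=; rewrite E1 subrr.
have {Dz} [u [v [Cu Dv dz]]] := Dz.
case: i li Cz Cu Dv dz => // i li Cz Cu Dv dz.
have Du : D l i (d i u).
  apply: Cregular => //; first exact: dC.
  have -> : x l *: d i u = - d i v.
    by apply/eqP; rewrite -addr_eq0 -dP -dz dd.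
  by rewrite -scaleN1r; apply/DZ/Dd.
have [e [u' [Cu' Du']]] := IH i u li (ltnW lq) Cu Du jq.
have Dy : D l i.+1 (d i.+1 (x j ^+ e *: z - x l *: u')).
  rewrite dB !dZ dz.
  have -> : x j ^+ e *: (x l *: u + v) - x l *: d i.+1 u' =
    x l *: (x j ^+ e *: u - d i.+1 u') + x j ^+ e *: v.
    by rewrite scalerDr scalerBr !scalerA mulrC addrAC.
  by apply: DP => //; apply: DZ.
have Cy : C i.+2 (x j ^+ e *: z - x l *: u') by apply: CB; apply: CZ.
have [e' [u'' [Cu'' Du'']]] := IH i.+1 _ (leqW li) (ltnW lq) Cy Dy jq.
exists (e' + e)%N, u''; split=> //.
exists (x j ^+ e' *: u'), (x j ^+ e' *: (x j ^+ e *: z - x l *: u') - d i.+2 u'').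
split=> //; first exact: CZ.
rewrite scalerBr !scalerA exprD [x l * _]mulrC !addrA.
by rewrite addrC -!addrA [X in _ = _ + X]addrC -!addrA addNr addr0 addrC.
Qed.

(** Descending induction on [l]: at [l = q] the condition [q <= i] forces [z = 0] by [Cbounded]. *)
Let exact_mod l i z :
  (l <= q)%N -> (l <= i)%N -> C i.+1 z -> D l i (d i z) ->
  exists2 u, C i.+2 u & D l i.+1 (z - d i.+1 u).
Proof.
move=> lq; rewrite -(subKn lq); move: (q - l)%N (leq_subr l q) => {l lq} l.
elim: l i z => [|l IH] i z lq.
  rewrite subn0 => qi Cz Dz; exists 0 => //.
  by rewrite (Cbounded _ Cz) // d0 subr0.
move=> li Cz Dz.
have [a [aq Ea Ea1]] : exists a, [/\ (a < q)%N, (q - l.+1)%N = a & (q - l)%N = a.+1].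
  by exists (q - l.+1)%N; split=> //; lia.
rewrite Ea in li Dz *; rewrite Ea1 in IH.
have [e [u [Cu Du]]] := torsion_mod li (ltnW aq) Cz Dz aq.
(* Descent on [e]. If [x a ^+ e.+1 *: z = d u] modulo [D a], then [u] is a cycle modulo [D a.+1], so
   [u = d u1 + x a *: u2 + u3] by exactness one index higher; cancelling [x a] leaves
   [x a ^+ e *: z = d u2] modulo [D a]. *)
elim: e u Cu Du => [|e IHe] u Cu Du.
  by exists u => //; rewrite expr0 scale1r in Du.
have Cy := CZ (x a ^+ e) Cz; rewrite exprS -scalerA in Du.
have Du' : D a.+1 i.+1 (d i.+1 u).
  exists (x a ^+ e *: z), (- (x a *: (x a ^+ e *: z) - d i.+1 u)); split=> //.
    by rewrite -scaleN1r; apply: DZ.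
  by rewrite opprB addrC subrK.
have [u1 Cu1 [u2 [u3 [Cu2 Du3 E1]]]] := IH i.+1 u (ltnW lq) li Cu Du'.
apply: (IHe u2) => //.
apply: Cregular => //; first by apply: CB => //; apply: dC.
have -> : x a *: (x a ^+ e *: z - d i.+1 u2) =
  (x a *: (x a ^+ e *: z) - d i.+1 u) + d i.+1 u3.
  rewrite scalerBr -addrA; congr (_ + _).
  have <- : d i.+1 (u - d i.+2 u1) = d i.+1 u by rewrite dB dd ?subr0.
  by rewrite E1 dP opprD addrNK.
by apply: DD => //; apply: Dd.
Qed.

Lemma acyclicity i z : C i.+1 z -> d i z = 0 ->
  exists2 u, C i.+2 u & z = d i.+1 u.
Proof.
move=> Cz dz; have [u Cu /eqP] := @exact_mod 0 i z isT isT Cz dz.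
by rewrite subr_eq0 => /eqP zu; exists u.
Qed.
End Acyclicity.

(** * Koszul complexes, exact up to multipliers *)

Section KoszulComplex.
Variables (A : comNzRingType) (S : comAlgType A) (s : nat) (c : 'I_s -> S).
Local Notation chain := {ffun {set 'I_s} -> S}.
Implicit Types (B K : {set 'I_s}) (w z u v : chain) (j l : 'I_s).

(** For [j] outside [K], the number of elements of [K] below [j] is the position [l] of [j] in
    [j |: K] minus one, so this is the sign [(-1)^(l+1)] of the differential. *)
Definition ksign K j : S := (-1) ^+ #|[set x in K | (x < j)%N]|.

Definition koszul w : chain :=
  [ffun K : {set 'I_s} => \sum_(j < s | j \notin K) ksign K j * c j * w (j |: K)].

Lemma ksignK K j : ksign K j * ksign K j = 1.
Proof. by rewrite /ksign -expr2 sqrr_sign. Qed.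

Lemma ksignU K j l : j \notin K ->
  ksign (j |: K) l = (-1) ^+ (j < l)%N * ksign K l.
Proof.
move=> jK; rewrite /ksign -exprD.
case jl: (j < l)%N => /=.
  congr (_ ^+ _); have -> : [set x in j |: K | (x < l)%N] =
      j |: [set x in K | (x < l)%N].
    by apply/setP=> x; rewrite !inE; case: eqP => //= ->.
  by rewrite cardsU1 !inE (negPf jK).
congr (_ ^+ #|pred_of_set _|); apply/setP=> x; rewrite !inE.
by case: eqP => //= ->; rewrite jl andbF.
Qed.

Lemma ksign_swap K j l : j != l -> j \notin K -> l \notin K ->
  ksign K j * ksign (j |: K) l = - (ksign K l * ksign (l |: K) j).
Proof.
move=> jl jK lK; rewrite !ksignU //.
have : (j < l)%N || (l < j)%N by rewrite -neq_ltn.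
case: ltngtP => //= _ _; rewrite ?expr1 ?expr0; ring.
Qed.

Lemma koszulP (a : A) u w : koszul (a *: u + w) = a *: koszul u + koszul w.
Proof.
apply/ffunP=> K; rewrite !ffunE scaler_sumr -big_split /=.
apply: eq_bigr => j _; rewrite !ffunE mulrDr; congr (_ + _).
by rewrite scalerAr.
Qed.

Lemma koszul0 : koszul 0 = 0.
Proof. by have := koszulP (-1) 0 0; rewrite !scaleN1r oppr0 addr0 addNr. Qed.

Lemma koszulZ (a : A) w : koszul (a *: w) = a *: koszul w.
Proof. by rewrite -[a *: w]addr0 koszulP koszul0 addr0. Qed.

Lemma koszulM (a : S) w :
  koszul [ffun K => a * w K] = [ffun K => a * koszul w K].
Proof.
apply/ffunP=> K; rewrite !ffunE mulr_sumr.
by apply: eq_bigr => j _; rewrite ffunE mulrCA.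
Qed.

Lemma koszul_koszul w : koszul (koszul w) = 0.
Proof.
apply/ffunP=> K; rewrite !ffunE.
pose F j l := ksign K j * c j * (ksign (j |: K) l * c l * w (l |: (j |: K))).
pose Q (j l : 'I_s) := [&& j \notin K, l \notin K & j != l].
transitivity (\sum_(p : 'I_s * 'I_s | Q p.1 p.2) F p.1 p.2).
  rewrite -(pair_big_dep (fun j => j \notin K)
    (fun j l => (l \notin K) && (j != l)) F) /=.
  apply: eq_bigr => j jK; rewrite ffunE mulr_sumr; apply: eq_bigl => l.
  by rewrite !inE negb_or andbC eq_sym.
(* The terms with [j < l] cancel those with [l < j] under the swap of the pair. *)
rewrite (bigID (fun p : 'I_s * 'I_s => (p.1 < p.2)%N)) /=.
rewrite [X in _ + X](reindex_inj (h := fun p => (p.2, p.1))) /=; last first.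
  by move=> [? ?] [? ?] [-> ->].
rewrite -[X in _ + X]opprK -sumrN; apply/eqP; rewrite subr_eq0; apply/eqP.
apply: eq_big => [[j l]|[j l] /=].
  rewrite /Q /= -leqNgt; case: (j \in K); case: (l \in K) => //=.
  by rewrite [l == j]eq_sym -(inj_eq val_inj) /=; case: ltngtP.
case/andP=> /and3P[jK lK jl] _.
have sw := ksign_swap jl jK lK.
have -> : F j l = (ksign K j * ksign (j |: K) l) * (c j * c l * w (l |: (j |: K))).
  by rewrite /F; ring.
by rewrite sw /F setUCA; ring.
Qed.

Definition supported B w := forall K, ~~ (K \subset B) -> w K = 0.
Definition degree (i : nat) w := forall K, #|K| != i -> w K = 0.
Definition in_span B (P : S) := exists Q : 'I_s -> S, P = \sum_(l in B) c l * Q l.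

Lemma in_spanD B P Q : in_span B P -> in_span B Q -> in_span B (P + Q).
Proof.
move=> [u ->] [v ->]; exists (fun l => u l + v l).
by rewrite -big_split; apply: eq_bigr => l _; rewrite mulrDr.
Qed.

Lemma in_spanM B a P : in_span B P -> in_span B (a * P).
Proof.
move=> [u ->]; exists (fun l => a * u l).
by rewrite mulr_sumr; apply: eq_bigr => l _; rewrite mulrCA.
Qed.

Lemma in_spanZ B (a : A) P : in_span B P -> in_span B (a *: P).
Proof. by rewrite -mulr_algl; apply: in_spanM. Qed.

Lemma in_span0 B : in_span B 0.
Proof. by exists (fun=> 0); rewrite big1 // => l _; rewrite mulr0. Qed.

Lemma in_span_gen B l : l \in B -> in_span B (c l).
Proof.
move=> lB; exists (fun l' => (l' == l)%:R).
rewrite (bigD1 l) //= eqxx mulr1 big1 ?addr0 // => l' /andP[_ /negPf->].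
by rewrite mulr0.
Qed.

Lemma koszul_set0 w : koszul w set0 = \sum_l c l * w [set l].
Proof.
rewrite ffunE; apply: eq_big => [l|l _]; first by rewrite inE.
rewrite /ksign (_ : [set _ in _ | _] = set0) ?cards0 ?expr0 ?mul1r ?setU0 //.
by apply/setP=> x; rewrite !inE.
Qed.

Lemma span_boundary B P : in_span B P ->
  exists u, [/\ supported B u, degree 1 u &
    koszul u = [ffun K => if K == set0 then P else 0]].
Proof.
move=> [Q ->].
pose u : chain := [ffun K : {set 'I_s} => \sum_(l in B | K == [set l]) Q l].
have u1 l : u [set l] = if l \in B then Q l else 0.
  rewrite ffunE; case: ifPn => lB.
    rewrite (big_pred1 l) // => x /=; rewrite (inj_eq set1_inj) eq_sym.
    by case: eqP => [->|]; rewrite ?lB ?andbF.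
  rewrite big_pred0 // => x; apply: contraNF lB => /andP[xB /eqP E].
  by have := set11 l; rewrite E inE => /eqP ->.
have udeg : degree 1 u.
  move=> K K1; rewrite ffunE big_pred0 // => l; apply: contraNF K1.
  by case/andP=> _ /eqP ->; rewrite cards1.
exists u; split=> //.
  move=> K KB; rewrite ffunE big_pred0 // => l; apply: contraNF KB.
  by case/andP=> lB /eqP ->; rewrite sub1set.
apply/ffunP=> K; rewrite [RHS]ffunE; case: eqP => [->|/eqP K0].
  rewrite koszul_set0 [RHS]big_mkcond /=; apply: eq_bigr => l _.
  by rewrite u1; case: ifP => //; rewrite mulr0.
rewrite ffunE big1 // => l lK; rewrite udeg ?mulr0 //.
by rewrite cardsU1 lK -[1%N]addn0 eqn_add2l cards_eq0.
Qed.

Section Peel.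
Variable L : A -> Prop.
Hypothesis L1 : L 1.
Hypothesis LM : forall x y, L x -> L y -> L (x * y).

(** The set [L] will be the complement of a prime; a single multiplier from [L] replaces the
    denominators of the localization. *)
Definition loc_span B P := exists2 a, L a & in_span B (a *: P).

Definition loc_exact B := forall i w,
  supported B w -> degree i.+1 w -> koszul w = 0 ->
  exists a u, [/\ L a, supported B u, degree i.+2 u & koszul u = a *: w].

Lemma loc_exact0 : loc_exact set0.
Proof.
move=> i w wB wi _; exists 1, 0; split=> //; try by move=> K _; rewrite ffunE.
rewrite koszul0 scale1r; apply/ffunP=> K; rewrite ffunE.
have [->|K0] := eqVneq K set0; first by rewrite wi // cards0.
by rewrite wB // subset0.
Qed.

(** The Koszul complex of [j |: B] is the mapping cone of [c j] on that of [B]: a chain is [part0]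
    plus [u_j] wedge [part1], and [ksign K j] moves [u_j] to its place. The identities
    [koszul_part0] and [koszul_part1] are the differential of the cone. *)
Definition part0 j w : chain := [ffun K : {set 'I_s} => if j \in K then 0 else w K].
Definition part1 j w : chain :=
  [ffun K : {set 'I_s} => if j \in K then 0 else ksign K j * w (j |: K)].
Definition glue j u v : chain :=
  [ffun K : {set 'I_s} => if j \in K then ksign (K :\ j) j * v (K :\ j) else u K].

Lemma koszul_part0 j w K : j \notin K ->
  koszul w K = c j * part1 j w K + koszul (part0 j w) K.
Proof.
move=> jK; rewrite !ffunE (bigD1 j) //= [in RHS](bigD1 j) //=.
rewrite ffunE !(setU11, jK) (negPf jK) mulr0 add0r; congr (_ + _).
  by rewrite -mulrA mulrCA.
apply: eq_bigr => l /andP[lK lj].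
by rewrite ffunE !inE eq_sym (negPf lj) (negPf jK).
Qed.

Lemma koszul_part1 j w K : j \notin K ->
  koszul (part1 j w) K = - (ksign K j * koszul w (j |: K)).
Proof.
move=> jK; rewrite !ffunE (bigD1 j) //= ffunE setU11 mulr0 add0r.
rewrite mulr_sumr -sumrN; apply: eq_big => [l|l /andP[lK lj]].
  by rewrite !inE negb_or andbC.
rewrite ffunE !inE eq_sym (negPf lj) (negPf jK) /= [j |: _]setUCA.
have jl : j != l by rewrite eq_sym.
set W := w _; have sw := ksign_swap jl jK lK.
transitivity (ksign K l * ksign (l |: K) j * (c l * W)); first by ring.
by rewrite -[ksign K l * _]opprK -sw; ring.
Qed.

Lemma koszul_part_in j w K : j \in K ->
  koszul (part0 j w) K = 0 /\ koszul (part1 j w) K = 0.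
Proof.
by move=> jK; split; rewrite ffunE big1 // => l _;
  rewrite ffunE !inE jK orbT mulr0.
Qed.

Lemma part0_glue j u v : (forall K, j \in K -> u K = 0) -> part0 j (glue j u v) = u.
Proof.
by move=> uj; apply/ffunP=> K; rewrite !ffunE; case: ifPn => [/uj->|/negPf->].
Qed.

Lemma part1_glue j u v : (forall K, j \in K -> v K = 0) -> part1 j (glue j u v) = v.
Proof.
move=> vj; apply/ffunP=> K; rewrite !ffunE; case: ifPn => [/vj->//|jK].
by rewrite setU11 setU1K // mulrA ksignK mul1r.
Qed.

Lemma supported_part j B w : j \notin B -> supported (j |: B) w ->
  supported B (part0 j w) /\ supported B (part1 j w).
Proof.
move=> jB wB; split=> K KB; rewrite ffunE; case: ifPn => // jK.
  rewrite wB //; apply: contra KB => /subsetP KjB; apply/subsetP=> x xK.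
  by have := KjB x xK; rewrite !inE; case: eqP => // E; rewrite -E xK in jK.
rewrite wB ?mulr0 //; apply: contra KB => /subsetP KjB; apply/subsetP=> x xK.
have := KjB x; rewrite !inE xK orbT; case: eqP => [E|_ /(_ isT)//].
by rewrite -E xK in jK.
Qed.

(** Long exact sequence of the cone. With [z0], [z1] the two parts of a cycle, [d z1 = 0] and
    [d z0 = - c j z1]; if [d u1 = a z1], then [a z0 + c j u1] is a cycle over [B]. *)
Lemma loc_exact_peel j B : j \notin B ->
  (forall P, loc_span B (c j * P) -> loc_span B P) ->
  loc_exact B -> loc_exact (j |: B).
Proof.
move=> jB reg exB i z zB zi dz.
have [z0B z1B] := supported_part jB zB.
have z0i : degree i.+1 (part0 j z).
  by move=> K Ki; rewrite ffunE; case: ifP => // _; apply: zi.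
have z1i : degree i (part1 j z).
  move=> K Ki; rewrite ffunE; case: ifPn => // jK; rewrite zi ?mulr0 //.
  by rewrite cardsU1 jK.
have dz0 : koszul (part0 j z) = - [ffun K => c j * part1 j z K].
  apply/ffunP=> K; case jK: (j \in K).
    have [-> _] := koszul_part_in z jK.
    by rewrite !ffunE jK mulr0 oppr0.
  have := koszul_part0 z (negbT jK); rewrite dz ffunE => /eqP.
  by rewrite eq_sym addrC addr_eq0 => /eqP ->; rewrite !ffunE.
have dz1 : koszul (part1 j z) = 0.
  apply/ffunP=> K; case jK: (j \in K).
    by have [_ ->] := koszul_part_in z jK; rewrite ffunE.
  by rewrite koszul_part1 ?jK // dz !ffunE mulr0 oppr0.
have [a [u1 [La u1B u1i du1]]] : exists a u1,
    [/\ L a, supported B u1, degree i.+1 u1 & koszul u1 = a *: part1 j z].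
  (* For [z] of degree one, [z1] is an element of [S] with [c j * z1] in [(c_B)]; the regularity of
     [c j] enters only here. *)
  case: i {zi z0i} z1i => [|i] z1i; last exact: exB.
  have [|a La aP] := reg (part1 j z set0).
    exists 1; rewrite // scale1r.
    exists (fun l => - part0 j z [set l]).
    have /(congr1 (fun w : chain => w set0)) := dz0.
    rewrite koszul_set0 [RHS]ffunE [X in _ = - X]ffunE => /eqP.
    rewrite eq_sym eqr_oppLR => /eqP ->.
    rewrite -sumrN [RHS]big_mkcond /=; apply: eq_bigr => l _.
    case: ifPn => lB; first by rewrite mulrN.
    by rewrite z0B ?mulr0 ?oppr0 // sub1set.
  have [u [uB u1 du]] := span_boundary aP.
  exists a, u; split=> //; rewrite du.
  apply/ffunP=> K; rewrite ffunE [RHS]ffunE; case: eqP => [->//|/eqP K0].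
  by rewrite z1i ?scaler0 // cards_eq0.
pose y : chain := a *: part0 j z + [ffun K => c j * u1 K].
have [||| b [u0 [Lb u0B u0i du0]]] := exB i y.
- move=> K KB; rewrite ffunE [X in X + _]ffunE [X in _ + X]ffunE.
  by rewrite z0B // u1B // mulr0 scaler0 addr0.
- move=> K KB; rewrite ffunE [X in X + _]ffunE [X in _ + X]ffunE.
  by rewrite z0i // u1i // mulr0 scaler0 addr0.
- rewrite koszulP koszulM dz0 du1; apply/ffunP=> K; rewrite !ffunE.
  by rewrite scalerN scalerAr addNr.
have jsub K : j \in K -> ~~ (K \subset B).
  by move=> jK; apply: contra jB => /subsetP; apply.
(* The minus sign compensates for [part1] anticommuting with the differential. *)
pose u := glue j u0 (- (b *: u1)).
have p0 : part0 j u = u0 by apply: part0_glue => K /jsub; apply: u0B.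
have p1 : part1 j u = - (b *: u1).
  by apply: part1_glue => K /jsub jK; rewrite !ffunE u1B // scaler0 oppr0.
exists (b * a), u; split; first exact: LM.
- move=> K KB; rewrite ffunE; case: ifPn => jK.
    rewrite !ffunE u1B ?scaler0 ?oppr0 ?mulr0 //; apply: contra KB => h.
    by rewrite -(setD1K jK); apply: setUS.
  by apply: u0B; apply: contra KB => h; apply: subset_trans h (subsetUr _ _).
- move=> K Ki; rewrite ffunE; case: ifPn => jK; last exact: u0i.
  rewrite !ffunE u1i ?scaler0 ?oppr0 ?mulr0 //.
  by apply: contra Ki; rewrite (cardsD1 j K) jK => /eqP ->.
apply/ffunP=> K; case jK: (j \in K).
  have jK' : j \notin K :\ j by rewrite !inE eqxx.
  have := koszul_part1 u jK'; rewrite p1 -scaleN1r scalerA koszulZ du1.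
  rewrite setD1K // => /(congr1 (fun t => - (ksign (K :\ j) j * t))).
  rewrite mulrN opprK mulrA ksignK mul1r => <-.
  rewrite !ffunE (negPf jK') setD1K //.
  rewrite mulN1r !scaleNr mulrN opprK scalerA -scalerAr mulrA ksignK mul1r.
  by [].
rewrite (koszul_part0 u (negbT jK)) p0 p1 du0 !ffunE jK.
by rewrite mulrN -scalerAr scalerDr !scalerA addrC addrK.
Qed.

End Peel.
End KoszulComplex.

(** * Clearing denominators, and minors invertible at a prime *)

Section Fractions.
Variable A : idomainType.
Local Open Scope quotient_scope.

Lemma fraction_clear (x : {fraction A}) :
  exists a b : A, b != 0 /\ tofrac b * x = tofrac a.
Proof.
elim/quotW: x => x.
exists (frac x).1, (frac x).2; split; first exact: denom_ratioP.
rewrite -[_ * _]/(FracField.mul _ _) !piE.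
apply/eqP; rewrite eqmodE /= FracField.equivfE /=.
rewrite /FracField.mulf !numden_Ratio ?mul1r ?mulr1 ?mulf_neq0 ?oner_neq0 ?denom_ratioP //.
Qed.

Lemma row_fraction_clear q (v : 'rV[{fraction A}]_q) :
  exists (b : A) (w : 'rV[A]_q), b != 0 /\ tofrac b *: v = map_mx (@tofrac A) w.
Proof.
have /fin_all_exists2[/= p p0 pP] i : exists2 p : A * A, p.2 != 0 &
    tofrac p.2 * v 0 i = tofrac p.1.
  by have [a [b [b0 E]]] := fraction_clear (v 0 i); exists (a, b).
exists (\prod_i (p i).2), (\row_i ((\prod_(l | l != i) (p l).2) * (p i).1)); split.
  by apply/prodf_neq0 => i _; apply: p0.
apply/rowP=> i; by rewrite !mxE (bigD1 i) //= rmorphM mulrAC pP mulrC -rmorphM.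
Qed.
End Fractions.

Section MaximalMinor.
Variables (A : comNzRingType) (F : fieldType) (pi : {rmorphism A -> F}).
Variables (r s : nat) (phi : 'M[A]_(r, s)).

(** Choose a square submatrix of [phi] of maximal size whose reduction is invertible: [d] is its
    determinant and [X] its adjugate padded with zeros, a left inverse up to [d] on the columns
    [B]. *)
Lemma unit_minor : exists (B : {set 'I_s}) (X : 'M[A]_(s, r)) (d : A),
  [/\ #|B| = \rank (map_mx pi phi), pi d != 0 &
    forall j l, j \in B -> l \in B -> (X *m phi) j l = d *+ (j == l)].
Proof.
set M := map_mx pi phi.
pose g := maxrankfun M^T.
have g_inj : injective g by move=> i j; apply: maxrankfun_inj.
have fullN : row_full (colsub g M).
  have -> : colsub g M = (rowsub g M^T)^T by apply/matrixP=> i j; rewrite !mxE.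
  by rewrite /row_full mxrank_tr; apply: maxrowsub_free.
pose h := fullrankfun fullN.
pose minor := mxsub h g phi.
exists [set g i | i : 'I_(\rank M^T)],
  (colsub g 1%:M *m \adj minor *m rowsub h 1%:M), (\det minor).
split.
- by rewrite card_imset // card_ord mxrank_tr.
- rewrite -det_map_mx -unitfE -unitmxE.
  have -> : map_mx pi minor = rowsub h (colsub g M).
    by apply/matrixP=> i j; rewrite !mxE.
  exact: fullrowsub_unit.
- move=> _ _ /imsetP[j _ ->] /imsetP[l _ ->].
  rewrite -!mulmxA mul_rowsub_mx mul1mx.
  have -> : (colsub g 1%:M *m (\adj minor *m rowsub h phi)) (g j) (g l) =
      (\adj minor *m minor) j l.
    rewrite mxE (bigD1 j) //= big1 => [|i ij].
      by rewrite !mxE eqxx mul1r addr0; apply: eq_bigr => i _; rewrite !mxE.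
    by rewrite !mxE (inj_eq g_inj) eq_sym (negPf ij) mul0r.
  by rewrite mul_adj_mx !mxE (inj_eq g_inj).
Qed.
End MaximalMinor.

(** * The linear forms [c_j] and substitution into forms *)

Section LinearForms.
Variables (A : idomainType) (r s : nat) (phi : 'M[A]_(r, s)).
Local Notation S := {mpoly A[r]}.

Definition linear_form (j : 'I_s) : S := \sum_(i < r) phi i j *: 'X_i.
Local Notation c := linear_form.

Lemma linear_form_homog j : c j \is 1.-homog.
Proof. by apply: rpred_sum => i _; apply: rpredZ; rewrite dhomogX /= mdeg1. Qed.

Lemma pihomogM (p q : S) t e :
  p \is t.-homog -> pihomog mdeg (t + e)%N (p * q) = p * pihomog mdeg e q.
Proof.
move=> pa; elim/mpolyind: q => [|x m q _ _ IH]; first by rewrite !(mulr0, pihomog0).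
rewrite mulrDr -scalerAr !linearP /= IH mulrDr -scalerAr; congr (_ *: _ + _).
have pX : p * 'X_[m] \is (t + mdeg m).-homog by apply: dhomogM; rewrite ?dhomogX.
rewrite [in RHS]pihomogX /=; case: eqP => [<-|/eqP ne]; first exact: pihomog_dE.
by rewrite mulr0 (pihomog_ne0 _ pX) // eqn_add2l.
Qed.

Lemma pihomogM_lt (p q : S) t e : (e < t)%N ->
  p \is t.-homog -> pihomog mdeg e (p * q) = 0.
Proof.
move=> ea pa; elim/mpolyind: q => [|x m q _ _ IH]; first by rewrite mulr0 pihomog0.
rewrite mulrDr -scalerAr linearP /= IH addr0.
have pX : p * 'X_[m] \is (t + mdeg m).-homog by apply: dhomogM; rewrite ?dhomogX.
by rewrite (pihomog_ne0 _ pX) ?scaler0 // neq_ltn (leq_trans ea) ?orbT ?leq_addr.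
Qed.

Lemma in_span_homog (B : {set 'I_s}) e P : P \is e.+1.-homog -> in_span c B P ->
  exists2 Q : 'I_s -> S, forall l, Q l \is e.-homog & P = \sum_(l in B) c l * Q l.
Proof.
move=> Pe [Q PQ]; exists (fun l => pihomog mdeg e (Q l)).
  by move=> l; apply: pihomogP.
rewrite -[LHS](pihomog_dE Pe) {1}PQ linear_sum; apply: eq_bigr => l _.
exact: (pihomogM _ _ (linear_form_homog l)).
Qed.

Lemma linear_form_eval (f : 'I_r -> A) j :
  (c j).@[f] = \sum_(i < r) phi i j * f i.
Proof.
by rewrite rmorph_sum; apply: eq_bigr => i _; rewrite /= mevalZ mevalXU.
Qed.

(** If [la *: 'X_i] is congruent to [g i], a monomial of degree [e] picks up one factor [la] per
    variable, by telescoping differences of products. This serves both the elimination of variables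
    and the comparison of [Sym^m I] with [I^m]. *)
Lemma homog_subst_cong (B : {set 'I_s}) (la : A) (g : 'I_r -> S) (e : nat) P :
  (forall i, in_span c B (la *: 'X_i - g i)) -> P \is e.-homog ->
  in_span c B (la ^+ e *: P - mmap (@mpolyC r A) g P).
Proof.
move=> cg Pe; rewrite {1}[P]mpolyE scaler_sumr /mmap -sumrB.
rewrite big_seq; apply: (big_ind (in_span c B)); first exact: in_span0.
  exact: in_spanD.
move=> m /(dhomog_mf Pe) /= <-.
rewrite scalerA mulrC -scalerA -mul_mpolyC -mulrBr; apply: in_spanM.
rewrite /mmap1 mdegE expr_sum mpolyXE_id -scaler_prod.
apply: (big_ind2 (fun x y => in_span c B (x - y))).
- by rewrite subrr; apply: in_span0.
- move=> x1 x2 y1 y2 hx hy.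
  have -> : x1 * y1 - x2 * y2 = y1 * (x1 - x2) + x2 * (y1 - y2) by ring.
  by apply: in_spanD; apply: in_spanM.
move=> i _; elim: (m i) => [|t IH].
  by rewrite !expr0 scale1r subrr; apply: in_span0.
rewrite -exprZn !exprS.
have -> : la *: 'X_i * (la *: 'X_i) ^+ t - g i * g i ^+ t =
  (la *: 'X_i) ^+ t * (la *: 'X_i - g i) + g i * ((la *: 'X_i) ^+ t - g i ^+ t) by ring.
by apply: in_spanD; apply: in_spanM => //; rewrite exprZn.
Qed.

End LinearForms.

(** * Elimination of linear forms at a prime *)

Section LocalStructure.
Variables (A : idomainType) (F : fieldType) (pi : {rmorphism A -> F}).
Variables (r s : nat) (phi : 'M[A]_(r, s)).
Local Notation S := {mpoly A[r]}.
Local Notation c := (linear_form phi).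

Definition loc_unit (a : A) : Prop := pi a != 0.
Local Notation L := loc_unit.

Lemma loc_unit1 : L 1. Proof. by rewrite /loc_unit rmorph1 oner_neq0. Qed.

Lemma loc_unitM a b : L a -> L b -> L (a * b).
Proof. by rewrite /loc_unit rmorphM => *; apply: mulf_neq0. Qed.

Lemma loc_unitX a e : L a -> L (a ^+ e).
Proof. by rewrite /loc_unit rmorphXn; apply: expf_neq0. Qed.

Lemma loc_unit_neq0 a : L a -> a != 0.
Proof. by apply: contra_neq => ->; rewrite rmorph0. Qed.

Lemma mpoly_scale_eq0 (a : A) (P : S) : a != 0 -> a *: P = 0 -> P = 0.
Proof.
move=> a0 /eqP; rewrite -mul_mpolyC mulf_eq0 mpolyC_eq0 (negPf a0) /=.
by move/eqP.
Qed.

Lemma loc_spanD B P Q :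
  loc_span c L B P -> loc_span c L B Q -> loc_span c L B (P + Q).
Proof.
move=> [a La aP] [b Lb bQ]; exists (b * a); first exact: loc_unitM.
rewrite scalerDr -scalerA; apply: in_spanD; first exact: in_spanZ.
by rewrite mulrC -scalerA; apply: in_spanZ.
Qed.

Section Unimodular.
Variables (B : {set 'I_s}) (X : 'M[A]_(s, r)) (d : A).
Hypothesis Ld : L d.
Hypothesis Xphi :
  forall j l, j \in B -> l \in B -> (X *m phi) j l = d *+ (j == l).

(* Over [A[1/d]] the linear forms [c_j], j \in B, are part of a coordinate
   system; [elim_var] is the corresponding projection with denominators
   cleared, so that its kernel is the ideal [(c_B)] after inverting [d]. *)
Definition elim_var (i : 'I_r) : S := d *: 'X_i - \sum_(j in B) X j i *: c j.
Definition elim_vars : S -> S := mmap (@mpolyC r A) elim_var.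

HB.instance Definition _ := GRing.RMorphism.on elim_vars.

Lemma elim_varsZ (a : A) P : elim_vars (a *: P) = a *: elim_vars P.
Proof. by rewrite /elim_vars mmapZ mul_mpolyC. Qed.

Lemma elim_vars_lin j : j \in B -> elim_vars (c j) = 0.
Proof.
move=> jB; rewrite rmorph_sum /=.
under eq_bigr => i _ do rewrite elim_varsZ /elim_vars mmapX mmap1U scalerBr.
rewrite sumrB.
have -> : \sum_(i < r) phi i j *: (d *: 'X_i) = d *: c j.
  by rewrite scaler_sumr; apply: eq_bigr => i _; rewrite !scalerA mulrC.
have -> : \sum_(i < r) phi i j *: (\sum_(l in B) X l i *: c l) =
    \sum_(l in B) (X *m phi) l j *: c l.
  under eq_bigr => i _ do rewrite scaler_sumr.
  rewrite exchange_big; apply: eq_bigr => l _; rewrite mxE scaler_suml.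
  by apply: eq_bigr => i _; rewrite scalerA mulrC.
rewrite (bigD1 j) //= Xphi // eqxx big1 ?addr0 ?subrr // => l /andP[lB lj].
by rewrite Xphi // (negPf lj) scale0r.
Qed.

Lemma elim_vars_span P : in_span c B P -> elim_vars P = 0.
Proof.
move=> [Q ->]; rewrite rmorph_sum big1 // => l lB.
by rewrite rmorphM /= elim_vars_lin ?mul0r.
Qed.

Lemma elim_vars_cong e P : P \is e.-homog ->
  in_span c B (d ^+ e *: P - elim_vars P).
Proof.
apply: homog_subst_cong => i; rewrite /elim_var opprB addrC subrK.
apply: (big_ind (in_span c B)); first exact: in_span0.
  exact: in_spanD.
by move=> j jB; apply/in_spanZ/in_span_gen.
Qed.

Lemma elim_var_homog i : elim_var i \is 1.-homog.
Proof.
apply: rpredB; first by apply: rpredZ; rewrite dhomogX /= mdeg1.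
by apply: rpred_sum => j _; apply/rpredZ/linear_form_homog.
Qed.

Lemma elim_vars_homog e P : P \is e.-homog -> elim_vars P \is e.-homog.
Proof.
move=> Pe; rewrite /elim_vars /mmap big_seq; apply: rpred_sum => m mP.
rewrite mul_mpolyC; apply: rpredZ; rewrite -(dhomog_mf Pe mP) /= /mmap1 mdegE.
apply: (big_ind2 (fun (x : S) t => x \is t.-homog)); first exact: dhomog1.
  by move=> *; apply: dhomogM.
by move=> i _; have := dhomogMn (m i) (elim_var_homog i); rewrite mul1n.
Qed.

Lemma pihomog_elim_vars e P :
  pihomog mdeg e (elim_vars P) = elim_vars (pihomog mdeg e P).
Proof.
elim/mpolyind: P => [|a m P _ _ IH]; first by rewrite !(rmorph0, pihomog0).
rewrite rmorphD /= elim_varsZ !linearP /= IH rmorphD /= elim_varsZ.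
congr (_ *: _ + _); have Xm : elim_vars 'X_[m] \is (mdeg m).-homog.
  by apply: elim_vars_homog; rewrite dhomogX.
rewrite pihomogX /=; case: eqP => [<-|/eqP ne]; first exact: pihomog_dE.
by rewrite rmorph0 (pihomog_ne0 ne Xm).
Qed.

(** Elimination kills the [c l] for [l] in [B], and on forms of degree [e] it is multiplication by
    [d ^+ e] modulo [(c_B)]. So [(c_B)] is, locally, the kernel of a morphism into a domain, and
    regularity reduces to nonvanishing. *)
Lemma loc_spanE P : loc_span c L B P <-> elim_vars P = 0.
Proof.
split=> [[a La /elim_vars_span]|P0].
  by rewrite elim_varsZ; apply/mpoly_scale_eq0/loc_unit_neq0.
rewrite (pihomog_partitionE (leqnn (mmeasure mdeg P))).
apply: (big_ind (loc_span c L B)) => [||e _].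
- by exists 1; [exact: loc_unit1 | rewrite scaler0; apply: in_span0].
- exact: loc_spanD.
- exists (d ^+ e); first exact: loc_unitX.
  have := elim_vars_cong (pihomogP mdeg e P).
  by rewrite -pihomog_elim_vars P0 pihomog0 subr0.
Qed.

Hypothesis phi_inj : forall h : 'I_s -> A,
  (forall i, \sum_(j < s) phi i j * h j = 0) -> forall j, h j = 0.

(** Otherwise some [a *: c j] is a combination of the [c l], [l] in [B]. Comparing coefficients of
    the ['X_i], where only the constant terms of the [Q l] enter, gives a relation between the
    columns of [phi] with coefficient [a] at [j]. *)
Lemma elim_vars_lin_neq0 j : j \notin B -> elim_vars (c j) != 0.
Proof.
move=> jB; apply/eqP => /loc_spanE[a La [Q cQ]].
pose h l := if l == j then a else if l \in B then - (Q l)@_0 else 0.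
suff /phi_inj/(_ j) : forall i, \sum_(l < s) phi i l * h l = 0.
  by rewrite /h eqxx => a0; move: (loc_unit_neq0 La); rewrite a0 eqxx.
move=> i; rewrite (bigD1 j) //= /h eqxx.
have c0 l : (c l)@_0 = 0.
  by apply: (dhomog_nemf_coeff (linear_form_homog phi l)); rewrite /= mdeg0.
have c1 l : (c l)^`M(i)@_0 = phi i l.
  rewrite mcoeff_mderiv mnm0E add0m mulr1n.
  rewrite /linear_form raddf_sum (bigD1 i) //= mcoeffZ mcoeffXU eqxx mulr1.
  rewrite big1 ?addr0 // => i' /negPf ne.
  by rewrite mcoeffZ mcoeffXU ne mulr0.
(* The coefficient of ['X_i] is read as the constant term of the derivative. *)
have := congr1 (fun P : S => (P^`M(i))@_0) cQ.
rewrite /= mderivZ mcoeffZ c1.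
rewrite (raddf_sum (mderiv i)) (raddf_sum (mcoeff 0%MM)) /= => E.
rewrite mulrC E; apply/eqP; rewrite addr_eq0 -sumrN.
rewrite [X in _ == X](bigID (mem B)) /= [X in _ == _ + X]big1 ?addr0; last first.
  by move=> l /andP[/negPf-> /negPf->]; rewrite mulr0 oppr0.
apply/eqP; apply: eq_big => [l|l lB].
  by case: eqP => [->|]; rewrite ?(negPf jB).
rewrite mderivM mcoeffD !rmorphM /= c0 mul0r addr0 c1 lB.
by case: eqP lB jB => [->->//|_ _ _]; rewrite mulrN opprK.
Qed.

Lemma loc_span_regular j P : j \notin B ->
  loc_span c L B (c j * P) -> loc_span c L B P.
Proof.
move=> jB /loc_spanE; rewrite rmorphM /= => /eqP; rewrite mulf_eq0.
by rewrite (negPf (elim_vars_lin_neq0 jB)) => /eqP/loc_spanE.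
Qed.

End Unimodular.
End LocalStructure.

(** * Local exactness, depth two and syzygies *)

Section LocalExactness.
Variables (A : idomainType) (F : fieldType) (pi : {rmorphism A -> F}).
Variables (r s : nat) (phi : 'M[A]_(r, s)).
Local Notation S := {mpoly A[r]}.
Local Notation c := (linear_form phi).
Local Notation L := (loc_unit pi).

Section Unimodular.
Variables (B : {set 'I_s}) (X : 'M[A]_(s, r)) (d : A).
Hypothesis Ld : L d.
Hypothesis Xphi :
  forall j l, j \in B -> l \in B -> (X *m phi) j l = d *+ (j == l).
Hypothesis phi_inj : forall h : 'I_s -> A,
  (forall i, \sum_(j < s) phi i j * h j = 0) -> forall j, h j = 0.
Hypothesis cardB : (s.-1 <= #|B|)%N.

Lemma cofull_set : B = setT \/ exists2 j, j \notin B & setT = j |: B.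
Proof.
have : (#|~: B| <= 1)%N by have := cardsC B; rewrite card_ord; lia.
rewrite leq_eqVlt ltnS leqn0 => /orP[/cards1P[j Bj]|/eqP/cards0_eq B0].
  right; exists j; first by rewrite -in_setC Bj set11.
  by rewrite -Bj setUC setUCr.
by left; rewrite -[B]setCK B0 setC0.
Qed.

(** The forms of [B] are adjoined one at a time, each subset of [B] inheriting the left inverse [X];
    at most one form remains. Every step is regular by [loc_span_regular]. *)
Lemma koszul_loc_exact : loc_exact c L setT.
Proof.
have subB e (B' : {set 'I_s}) : #|B'| = e -> B' \subset B -> loc_exact c L B'.
  elim: e B' => [|e IH] B'.
    by move=> /cards0_eq -> _; apply/loc_exact0/loc_unit1.
  move=> cB' sB'; have [j jB'] : exists j, j \in B'.
    by apply/set0Pn; rewrite -card_gt0 cB'.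
  rewrite -(setD1K jB'); apply: loc_exact_peel.
  - exact: loc_unit1.
  - exact: loc_unitM.
  - by rewrite !inE eqxx.
  - have sub' : B' :\ j \subset B by apply: subset_trans sB'; apply: subD1set.
    move=> P; apply: (loc_span_regular (X := X) Ld) => //.
      by move=> l l' /(subsetP sub') lB /(subsetP sub') l'B; apply: Xphi.
    by rewrite !inE eqxx.
  - apply: IH; last by apply: subset_trans sB'; apply: subD1set.
    by have := cardsD1 j B'; rewrite jB' cB' => -[].
have exB := subB _ B erefl (subxx B).
have [<- //|[j jB ->]] := cofull_set.
apply: loc_exact_peel => //; [exact: loc_unit1|exact: loc_unitM|].
by move=> P; apply: (loc_span_regular (X := X) Ld).
Qed.

Section Depth.
Variables h1 h2 : A.
Hypothesis h1_neq0 : h1 != 0.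
Hypothesis h12_regular : forall a b, h2 * a = h1 * b ->
  exists2 t, L t & exists e, t * a = h1 * e.

Lemma mpoly_regular (P Q : S) : h2 *: P = h1 *: Q ->
  exists2 t, L t & exists W : S, t *: P = h1 *: W.
Proof.
move=> PQ; rewrite [P]mpolyE; apply: (big_ind (fun P : S =>
  exists2 t, L t & exists W : S, t *: P = h1 *: W)).
- by exists 1; [exact: loc_unit1 | exists 0; rewrite !scaler0].
- move=> P1 P2 [t1 Lt1 [W1 E1]] [t2 Lt2 [W2 E2]].
  exists (t1 * t2); first exact: loc_unitM.
  exists (t2 *: W1 + t1 *: W2).
  rewrite !scalerDr mulrC -scalerA E1 mulrC -scalerA E2 !scalerA.
  by rewrite [t2 * _]mulrC [t1 * _]mulrC.
- move=> m _; have [|t Lt [e te]] := h12_regular (a := P@_m) (b := Q@_m).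
    by rewrite -!mcoeffZ PQ.
  by exists t => //; exists (e *: 'X_[m]); rewrite !scalerA te.
Qed.

(* With [h1 P = c_j Q1] and [h2 P = c_j Q2] modulo the other linear forms,
   [h2 Q1 = h1 Q2], hence [h1] divides [Q1] and [c_j] divides [P]. *)
Lemma loc_span_depth2 e P : P \is e.+1.-homog ->
  loc_span c L setT (h1 *: P) -> loc_span c L setT (h2 *: P) ->
  loc_span c L setT P.
Proof.
pose rho := elim_vars phi B X d.
have rhoZ a Q : rho (a *: Q) = a *: rho Q by apply: elim_varsZ.
have rhoE Q := loc_spanE Ld Xphi Q.
move=> Pe hP1 hP2; have [BT|[j jB setTE]] := cofull_set.
  rewrite -BT in hP1 *; apply/rhoE.
  by move/rhoE: hP1; rewrite -/(rho _) rhoZ; apply: mpoly_scale_eq0.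
have split_span h : loc_span c L setT (h *: P) -> exists a Q,
    [/\ L a, Q \is e.-homog & (a * h) *: rho P = rho (c j) * rho Q].
  move=> [a La aP].
  have Ph : a *: (h *: P) \is e.+1.-homog by do 2!apply: rpredZ.
  have [Q Qe E] := in_span_homog Ph aP.
  exists a, (Q j); split=> //; rewrite -rhoZ -scalerA E setTE big_setU1 //=.
  rewrite /rho rmorphD rmorphM /= -/(rho _) [X in _ + X](elim_vars_span Xphi) ?addr0 //.
  by exists Q.
have [a1 [Q1 [La1 Q1e E1]]] := split_span _ hP1.
have [a2 [Q2 [La2 Q2e E2]]] := split_span _ hP2.
have rc0 : rho (c j) != 0 by apply: elim_vars_lin_neq0 Ld Xphi phi_inj _ jB.
have /mpoly_regular[t Lt [W tW]] : h2 *: (a2 *: rho Q1) = h1 *: (a1 *: rho Q2).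
  apply: (mulfI rc0); rewrite -!scalerAr -E1 -E2 !scalerA.
  by congr (_ *: _); ring.
(* [W] need not be a value of [rho], so [rho] is applied once more to [t a2 rho(Q1) = h1 W]; in
   degree [e], [rho] twice is [d ^+ e] times [rho], which explains the factor [d ^+ e] of [tau]. *)
have dQ : d ^+ e *: rho Q1 = rho (rho Q1).
  apply/eqP; rewrite -subr_eq0 -rhoZ /rho -rmorphB.
  by apply/eqP/(elim_vars_span Xphi)/elim_vars_cong.
pose tau := t * a2 * d ^+ e.
have : rho (tau *: (a1 *: P) - c j * W) = 0.
  apply: (mpoly_scale_eq0 h1_neq0).
  rewrite /rho rmorphB rmorphM /= -!/(rho _) !rhoZ scalerBr scalerAr.
  rewrite -[h1 *: rho W]rhoZ -tW !rhoZ -dQ.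
  have -> : h1 *: (tau *: (a1 *: rho P)) = tau *: ((a1 * h1) *: rho P).
    by rewrite !scalerA; congr (_ *: _); ring.
  rewrite E1 -!scalerAr !scalerA -mulrA -/tau.
  by rewrite /tau !mulrA subrr.
move/rhoE => [b Lb bU]; exists (b * (tau * a1)).
  by do !apply: loc_unitM => //; apply: loc_unitX.
have -> : (b * (tau * a1)) *: P =
    b *: (tau *: (a1 *: P) - c j * W) + c j * (b *: W).
  by rewrite scalerBr -scalerAr subrK !scalerA.
apply: in_spanD; last by rewrite mulrC; apply/in_spanM/in_span_gen; rewrite inE.
have [Q ->] := bU; apply: (big_ind (in_span c setT)).
- exact: in_span0.
- exact: in_spanD.
- by move=> l _; rewrite mulrC; apply/in_spanM/in_span_gen; rewrite inE.
Qed.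

Lemma loc_spanZ (C : {set 'I_s}) a P : loc_span c L C P -> loc_span c L C (a *: P).
Proof.
move=> [b Lb bP]; exists b => //.
by rewrite scalerA mulrC -scalerA; apply: in_spanZ.
Qed.

Lemma loc_span_depth2_exp a b e P : P \is e.+1.-homog ->
  loc_span c L setT (h1 ^+ a *: P) -> loc_span c L setT (h2 ^+ b *: P) ->
  loc_span c L setT P.
Proof.
have [q] := ubnP (a + b); elim: q a b P => // q IH [|a] [|b] P abq Pe.
- by rewrite expr0 scale1r.
- by rewrite expr0 scale1r.
- by rewrite expr0 scale1r.
move=> aP bP; apply: (loc_span_depth2 Pe).
  apply: (IH a b.+1); [lia | exact: rpredZ | by rewrite scalerA -exprSr |].
  by rewrite scalerA mulrC -scalerA; apply: loc_spanZ.
apply: (IH a.+1 b); [lia | exact: rpredZ | | by rewrite scalerA -exprSr].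
by rewrite scalerA mulrC -scalerA; apply: loc_spanZ.
Qed.

End Depth.
End Unimodular.

Section Syzygies.
Variable f : 'I_r -> A.
Hypothesis phi_syz : forall j, \sum_(i < r) phi i j * f i = 0.
Hypothesis syz_phi : forall g : 'I_r -> A, \sum_(i < r) g i * f i = 0 ->
  exists h : 'I_s -> A, forall i, g i = \sum_(j < s) phi i j * h j.

Lemma syzygy_span g : \sum_(i < r) g i * f i = 0 ->
  in_span c setT (\sum_(i < r) g i *: 'X_i).
Proof.
move=> /syz_phi[h gE]; exists (fun j => (h j)%:MP).
under eq_bigr => i _ do rewrite gE scaler_suml.
rewrite exchange_big; apply: eq_big => [j|j _]; first by rewrite inE.
rewrite mulrC mul_mpolyC scaler_sumr; apply: eq_bigr => i _.
by rewrite scalerA mulrC.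
Qed.

(** The form [la *: 'X_j - f j *: Y] comes from the syzygy with entries
    [la *+ (i == j) - f j * y i], hence lies in [(c)]; substituting [f i *: Y] into [P] gives
    [P.@[f] *: Y ^+ e] by homogeneity. When [P.@[f] = 0], the [e]-th power of any element of [I]
    thus kills [P] modulo [(c)]. *)
Lemma rees_cong (y : 'I_r -> A) e P : P \is e.-homog ->
  in_span c setT ((\sum_(i < r) y i * f i) ^+ e *: P
                  - P.@[f] *: (\sum_(i < r) y i *: 'X_i) ^+ e).
Proof.
set la := \sum_(i < r) _; set Y := \sum_(i < r) _ => Pe.
have -> : P.@[f] *: Y ^+ e = mmap (@mpolyC r A) (fun i => f i *: Y) P.
  rewrite mevalE scaler_suml /mmap !big_seq; apply: eq_bigr => m mP.
  rewrite mul_mpolyC -scalerA; congr (_ *: _); rewrite /mmap1.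
  under [RHS]eq_bigr => i _ do rewrite exprZn.
  rewrite scaler_prod -expr_sum -mdegE; congr (_ *: _ ^+ _).
  by rewrite -(dhomog_mf Pe mP).
apply: homog_subst_cong Pe => j.
have -> : la *: 'X_j - f j *: Y =
    \sum_(i < r) (la *+ (i == j) - f j * y i) *: 'X_i.
  under eq_bigr => i _ do rewrite scalerBl -scalerA.
  rewrite sumrB -scaler_sumr (bigD1 j) //= eqxx big1 ?addr0 // => i /negPf->.
  by rewrite scale0r.
apply: syzygy_span; under eq_bigr => i _ do rewrite mulrBl -mulrA.
rewrite sumrB -mulr_sumr -/la (bigD1 j) //= eqxx big1 ?addr0.
  by rewrite mulr1n mulrC subrr.
by move=> i /negPf->; rewrite mul0r.
Qed.

Lemma rees_loc_unit i e P : L (f i) -> P \is e.-homog -> P.@[f] = 0 ->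
  loc_span c L setT P.
Proof.
move=> Lf Pe Pf; exists (f i ^+ e); first exact: loc_unitX.
have := rees_cong (fun l => (l == i)%:R) Pe.
rewrite Pf scale0r subr0 (bigD1 i) //= eqxx mul1r big1 ?addr0 // => l /negPf->.
by rewrite mul0r.
Qed.

Lemma rees_loc_multiple t h (y : 'I_r -> A) e P : L t ->
  t * h = \sum_(i < r) y i * f i -> P \is e.-homog -> P.@[f] = 0 ->
  loc_span c L setT (h ^+ e *: P).
Proof.
move=> Lt th Pe Pf; exists (t ^+ e); first exact: loc_unitX.
by have := rees_cong y Pe; rewrite Pf scale0r subr0 -th exprMn -scalerA.
Qed.

(* The syzygies [t e_i - sum_j (U V)_ij e_j] give [t Id = U V + H phi^T]. *)
Lemma rank_loc q (U : 'M[A]_(r, q)) (V : 'M[A]_(q, r)) t : L t ->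
  (forall i, t * f i = \sum_(j < r) (U *m V) i j * f j) ->
  (r <= q + \rank (map_mx pi phi))%N.
Proof.
move=> Lt UV.
have /fin_all_exists[H HE] i : exists h : 'I_s -> A, forall l,
    t *+ (l == i) - (U *m V) i l = \sum_(j < s) phi l j * h j.
  apply: syz_phi; under eq_bigr => l _ do rewrite mulrBl.
  rewrite sumrB -UV (bigD1 i) //= eqxx big1 ?addr0 ?subrr // => l /negPf->.
  by rewrite mul0r.
have E : t%:M = U *m V + (\matrix_(i, j) H i j) *m phi^T.
  apply/matrixP=> i l; rewrite [RHS]mxE [X in _ = _ + X]mxE.
  have -> : \sum_j (\matrix_(i, j) H i j) i j * phi^T j l =
      t *+ (l == i) - (U *m V) i l.
    by rewrite HE; apply: eq_bigr => j _; rewrite !mxE mulrC.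
  by rewrite addrC subrK mxE eq_sym.
have := congr1 (fun M => \rank (map_mx pi M)) E.
rewrite map_scalar_mx -scalemx1 mxrank_scale_nz // mxrank1 => {1}->.
rewrite map_mxD !map_mxM -map_trmx; apply: leq_trans (mxrank_add _ _) _.
apply: leq_add; first by apply: leq_trans (mxrankM_maxl _ _) (rank_leq_col _).
by apply: leq_trans (mxrankM_maxr _ _) _; rewrite mxrank_tr.
Qed.

End Syzygies.
End LocalExactness.

(** * Fewer relations than generators *)

Section RankBound.
Variables (A : idomainType) (r s : nat) (phi : 'M[A]_(r, s)) (f : 'I_r -> A).
Hypothesis phi_inj : forall h : 'I_s -> A,
  (forall i, \sum_(j < s) phi i j * h j = 0) -> forall j, h j = 0.
Hypothesis phi_syz : forall j, \sum_(i < r) phi i j * f i = 0.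

(** Over the fraction field [phi] has rank [s], and the row of the [f i] is a nonzero vector
    annihilated by it, so [1 + s <= r]. *)
Lemma syzygy_rank_lt i0 : f i0 != 0 -> (s < r)%N.
Proof.
move=> fi0; pose M := map_mx (@tofrac A) phi.
have rM : \rank M = s.
  rewrite -mxrank_tr; apply/eqP; apply: inj_row_free => v vM.
  have [b [w [b0 bv]]] := row_fraction_clear v.
  have w0 : forall j, w 0 j = 0.
    apply: phi_inj => i; apply/eqP; rewrite -tofrac_eq0; apply/eqP.
    have := congr1 (fun N : 'rV_r => (tofrac b *: N) 0 i) vM.
    rewrite scaler0 scalemxAl bv !mxE => E; rewrite -[RHS]E rmorph_sum.
    by apply: eq_bigr => j _; rewrite rmorphM !mxE mulrC.
  have : tofrac b *: v = 0.
    by rewrite bv; apply/rowP=> j; rewrite !mxE w0 rmorph0.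
  by move/eqP; rewrite scaler_eq0 tofrac_eq0 (negPf b0) => /eqP.
pose g : 'rV[{fraction A}]_r := \row_i tofrac (f i).
have gM : g *m M = 0.
  apply/rowP=> j; rewrite !mxE -[RHS](rmorph0 (@tofrac A)) -(phi_syz j) rmorph_sum.
  by apply: eq_bigr => i _; rewrite !mxE rmorphM mulrC.
have := mulmx0_rank_max gM; rewrite rM rank_rV.
suff -> : g != 0 by rewrite add1n.
by apply/eqP => /rowP/(_ i0); rewrite !mxE => /eqP; rewrite tofrac_eq0 (negPf fi0).
Qed.
End RankBound.

(** * The strand of degree [m] *)

Section Strand.
Variables (A : idomainType) (r s : nat) (phi : 'M[A]_(r, s)).
Local Notation S := {mpoly A[r]}.
Local Notation c := (linear_form phi).
Local Notation chain := {ffun {set 'I_s} -> S}.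
Implicit Types (w u z : chain) (m i : nat).

(* For [i <= m] this is [inC m i]; the strand stops at [i = m], whereas the
   truncated subtraction [m - i] would make [inC m i] nonzero beyond. *)
Definition strand m i w := forall (K : {set 'I_s}) (mon : 'X_{1..r}),
  ~~ [&& (i <= m)%N, #|K| == i & mdeg mon == (m - i)%N] -> (w K)@_mon = 0.

Lemma strandP m i w : (i <= m)%N -> strand m i w <->
  forall K : {set 'I_s}, (#|K| != i -> w K = 0) /\ w K \is (m - i).-homog.
Proof.
move=> im; split=> [wC K|wC K mon].
  split=> [Ki|].
    by apply/mpolyP => mon; rewrite mcoeff0 wC // (negPf Ki) andbF.
  apply/dhomogP => mon; rewrite mcoeff_msupp; apply: contraNeq => mone.
  by rewrite wC //= (negPf mone) !andbF.
rewrite im /= negb_and => /orP[/(proj1 (wC K))->|mone]; first by rewrite mcoeff0.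
exact: (dhomog_nemf_coeff (proj2 (wC K))).
Qed.

Lemma strand_gt m i w : (m < i)%N -> strand m i w -> w = 0.
Proof.
move=> mi wC; apply/ffunP=> K; rewrite ffunE; apply/mpolyP => mon.
by rewrite mcoeff0 wC // leqNgt mi.
Qed.

Lemma strand0 m i : strand m i 0.
Proof. by move=> K mon _; rewrite ffunE mcoeff0. Qed.

Lemma strand_koszul m i w : strand m i.+1 w -> strand m i (koszul c w).
Proof.
have [im|mi] := leqP i.+1 m; last first.
  by move=> /(strand_gt mi)->; rewrite koszul0; apply: strand0.
move=> /(strandP _ im) wC; apply/(strandP _ (ltnW im)) => K; split=> [Ki|].
  rewrite ffunE big1 // => j jK; rewrite (proj1 (wC (j |: K))) ?mulr0 //.
  by rewrite cardsU1 jK.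
rewrite ffunE; apply: rpred_sum => j jK; have [_ wh] := wC (j |: K).
rewrite -mulrA /ksign rpredMsign (_ : (m - i = 1 + (m - i.+1))%N); last lia.
by apply: dhomogM => //; apply: linear_form_homog.
Qed.

Lemma koszul_eval (f : 'I_r -> A) w :
  (forall j, \sum_(i < r) phi i j * f i = 0) -> (koszul c w set0).@[f] = 0.
Proof.
move=> fs; rewrite koszul_set0 rmorph_sum big1 // => l _.
by rewrite rmorphM /= linear_form_eval fs mul0r.
Qed.

(** Local boundaries come with primitives of unknown [t]-degree; this projection commutes with the
    differential and brings them back into the strand. *)
Definition strand_proj m i w : chain := [ffun K : {set 'I_s} =>
  if (i <= m)%N && (#|K| == i) then pihomog mdeg (m - i)%N (w K) else 0].

Lemma strand_projP m i w : strand m i (strand_proj m i w).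
Proof.
move=> K mon; rewrite ffunE; case: ifP => [/andP[-> ->] /= mone|_ _].
  exact: (dhomog_nemf_coeff (pihomogP _ _ _)).
by rewrite mcoeff0.
Qed.

Lemma strand_proj_id m i w : strand m i w -> strand_proj m i w = w.
Proof.
have [im|mi] := leqP i m; last first.
  move=> /(strand_gt mi)->; apply/ffunP=> K; rewrite !ffunE.
  by rewrite leqNgt mi.
move=> /(strandP _ im) wC; apply/ffunP=> K; rewrite ffunE im /=.
case: eqP => [_|/eqP Ki]; first by apply/pihomog_dE/(proj2 (wC K)).
by rewrite (proj1 (wC K) Ki).
Qed.

Lemma strand_projZ m i a w : strand_proj m i (a *: w) = a *: strand_proj m i w.
Proof.
apply/ffunP=> K; rewrite !ffunE; case: ifP => _; first by rewrite linearZ.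
by rewrite scaler0.
Qed.

Lemma koszul_strand_proj m i w : (i <= m)%N ->
  koszul c (strand_proj m i.+1 w) = strand_proj m i (koszul c w).
Proof.
move=> im; apply/ffunP=> K; rewrite !ffunE im /=.
have sc j : ksign S K j * c j \is 1.-homog.
  by rewrite /ksign rpredMsign; apply: linear_form_homog.
have cardU j : j \notin K -> (#|j |: K| == i.+1) = (#|K| == i).
  by move=> jK; rewrite cardsU1 jK.
case: ifPn => Ki; last first.
  rewrite big1 // => j jK; rewrite ffunE cardU // (negPf Ki) andbF mulr0 //.
rewrite linear_sum /=; apply: eq_bigr => j jK; rewrite ffunE cardU // Ki andbT.
case: ltnP => mi.
  rewrite -(pihomogM _ _ (sc j)); congr (pihomog _ _ _); lia.
(* Here [i = m]: a multiple of [c j] has no component of degree zero. *)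
by rewrite mulr0 (pihomogM_lt _ _ (sc j)) //; lia.
Qed.

Lemma strand_boundary m i a z u : (i <= m)%N -> strand m i z ->
  koszul c u = a *: z -> exists2 v, strand m i.+1 v & koszul c v = a *: z.
Proof.
move=> im zC uz; exists (strand_proj m i.+1 u); first exact: strand_projP.
by rewrite koszul_strand_proj // uz strand_projZ strand_proj_id.
Qed.

End Strand.

(** * Division by a variable, coefficient by coefficient *)

Section VariableDivision.
Variables (n : nat) (k : idomainType) (l : 'I_n).
Local Notation R := {mpoly k[n]}.

Definition var_quo (p : R) : R :=
  \sum_(m <- msupp p | m l != 0%N) p@_m *: 'X_[m - U_(l)].
Definition var_rem (p : R) : R :=
  \sum_(m <- msupp p | m l == 0%N) p@_m *: 'X_[m].

Lemma var_quo0 : var_quo 0 = 0.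
Proof. by rewrite /var_quo (_ : msupp 0 = [::]) ?big_nil // -mpolyC0 msupp0. Qed.

Lemma var_rem0 : var_rem 0 = 0.
Proof. by rewrite /var_rem (_ : msupp 0 = [::]) ?big_nil // -mpolyC0 msupp0. Qed.

Lemma var_divE p : p = 'X_l * var_quo p + var_rem p.
Proof.
rewrite {1}[p]mpolyE (bigID (fun m : 'X_{1..n} => m l != 0%N)) /=.
congr (_ + _); last by apply: eq_bigl => m; rewrite negbK.
rewrite mulr_sumr; apply: eq_bigr => m ml.
rewrite -scalerAr -mpolyXD addmC submK //; apply/mnm_lepP => i.
by rewrite mnm1E; case: eqP => // <-; rewrite lt0n.
Qed.

Lemma mcoeff_var_rem p m : (var_rem p)@_m = if m l == 0%N then p@_m else 0.
Proof.
rewrite /var_rem raddf_sum /=.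
under eq_bigr => m' _ do rewrite mcoeffZ mcoeffX.
have [ml|ml] := ifPn; last first.
  apply: big1 => m' m'l; case: eqP => [E|_]; last by rewrite mulr0.
  by rewrite -E m'l in ml.
have [mp|mp] := boolP (m \in msupp p).
  rewrite big_mkcond (bigD1_seq m) ?msupp_uniq //= ml eqxx mulr1.
  by rewrite big1 ?addr0 // => m' /negPf->; rewrite mulr0 if_same.
rewrite (memN_msupp_eq0 mp) big_seq_cond big1 // => m' /andP[m'p _].
by case: eqP mp => [<-|]; rewrite ?m'p ?mulr0.
Qed.

Lemma mcoeff_varM (p : R) (m : 'X_{1..n}) : m l = 0%N -> ('X_l * p)@_m = 0.
Proof.
move=> ml; apply: memN_msupp_eq0; rewrite mulrC (perm_mem (msuppMX _ _)).
apply/mapP => -[m' _ E]; have := congr1 (fun m : 'X_{1..n} => m l) E.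
by rewrite ml mnmDE mnm1E eqxx add1n.
Qed.

Lemma mcoeff_varM_add (p : R) m : ('X_l * p)@_(m + U_(l)) = p@_m.
Proof. by rewrite mulrC addmC mcoeffMX. Qed.

End VariableDivision.

Section CoefficientMap.
Variables (A : idomainType) (r s : nat).
Local Notation chain := {ffun {set 'I_s} -> {mpoly A[r]}}.

(** The map [g] will be the quotient or the remainder by a variable; [g 0 = 0] suffices to keep a
    chain in its strand. *)
Definition coeff_map (g : A -> A) (w : chain) : chain :=
  [ffun K : {set 'I_s} => \sum_(m <- msupp (w K)) g (w K)@_m *: 'X_[m]].

Lemma coeff_mapE g w K m : g 0 = 0 -> (coeff_map g w K)@_m = g (w K)@_m.
Proof.
move=> g0; rewrite ffunE raddf_sum /=.
under eq_bigr => m' _ do rewrite mcoeffZ mcoeffX.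
have [mp|mp] := boolP (m \in msupp (w K)).
  rewrite (bigD1_seq m) ?msupp_uniq //= eqxx mulr1 big1 ?addr0 // => m'.
  by move=> /negPf->; rewrite mulr0.
rewrite (memN_msupp_eq0 mp) g0 big_seq big1 // => m' m'p.
by case: eqP mp => [<-|]; rewrite ?m'p ?mulr0.
Qed.
End CoefficientMap.

(** * Powers of [I] as values of forms *)

Section GeneratedIdeal.
Variables (n : nat) (k : closedFieldType) (r : nat).
Local Notation R := {mpoly k[n.+1]}.
Variable f : 'I_r -> R.
Local Notation I := (ideal_of [seq f i | i : 'I_r]).

Lemma ideal_ofP x : I x <-> exists g : 'I_r -> R, x = \sum_(i < r) g i * f i.
Proof.
have sz : size [seq f i | i : 'I_r] = r by rewrite size_image card_ord.
have nthE (i : 'I_r) : [seq f i | i : 'I_r]`_i = f i.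
  by rewrite (nth_map i) ?size_enum_ord // nth_ord_enum.
have sumE (cs : seq R) : \sum_(i < size [seq f i | i : 'I_r])
    cs`_i * [seq f i | i : 'I_r]`_i = \sum_(i < r) cs`_i * f i.
  rewrite -(big_mkord predT (fun i => cs`_i * [seq f i | i : 'I_r]`_i)) sz.
  by rewrite big_mkord; apply: eq_bigr => i _; rewrite nthE.
split=> [[cs ->]|[g ->]]; first by exists (fun i => cs`_i); rewrite sumE.
exists [seq g i | i : 'I_r]; rewrite sumE; apply: eq_bigr => i _.
by rewrite (nth_map i) ?size_enum_ord // nth_ord_enum.
Qed.

Lemma ideal_of_ideal : is_ideal I.
Proof.
split.
- by apply/ideal_ofP; exists (fun=> 0); rewrite big1 // => i _; rewrite mul0r.
- move=> x y /ideal_ofP[g ->] /ideal_ofP[h ->]; apply/ideal_ofP.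
  exists (fun i => g i + h i); rewrite -big_split.
  by apply: eq_bigr => i _; rewrite mulrDl.
- move=> a x /ideal_ofP[g ->]; apply/ideal_ofP; exists (fun i => a * g i).
  by rewrite mulr_sumr; apply: eq_bigr => i _; rewrite mulrA.
Qed.

Lemma ideal_pow_ideal e : is_ideal (ideal_pow I e).
Proof.
case: e => [//|e /=]; split.
- by exists 0%N, (fun=> 0), (fun=> 0); rewrite big_ord0; split=> [[]|] //; split=> [[]|].
- move=> _ _ [N1 [a1 [b1 [Ia1 [Ib1 ->]]]]] [N2 [a2 [b2 [Ia2 [Ib2 ->]]]]].
  exists (N1 + N2)%N, (fun l => match split l with inl i => a1 i | inr j => a2 j end),
    (fun l => match split l with inl i => b1 i | inr j => b2 j end).
  split; first by move=> l; case: split.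
  split; first by move=> l; case: split.
  rewrite big_split_ord /=; congr (_ + _); apply: eq_bigr => i _.
    by rewrite (unsplitK (inl i)).
  by rewrite (unsplitK (inr i)).
- move=> c _ [N [a [b [Ia [Ib ->]]]]]; exists N, (fun l => c * a l), b.
  split; first by move=> l; case: ideal_of_ideal => _ _; apply.
  by split=> //; rewrite mulr_sumr; apply: eq_bigr => l _; rewrite mulrA.
Qed.

Lemma ideal_pow_monomial e (m : 'X_{1..r}) : mdeg m = e ->
  ideal_pow I e (\prod_(i < r) f i ^+ m i).
Proof.
elim: e m => [//|e IH] m me.
have [i mi] : exists i, m i != 0%N.
  apply: boolp.contrapT => H; move: me; rewrite (_ : m = 0%MM) ?mdeg0 //.
  by apply/mnmP => i; rewrite mnm0E; apply/eqP/negPn/negP => mi; apply: H; exists i.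
have mE : m = (U_(i) + (m - U_(i)))%MM.
  rewrite addmC submK //; apply/mnm_lepP => j.
  by rewrite mnm1E; case: eqP => // <-; rewrite lt0n.
have me' : mdeg (m - U_(i))%MM = e.
  by move: me; rewrite mE mdegD mdeg1 => -[]; rewrite -mE.
exists 1%N, (fun=> f i), (fun=> \prod_(j < r) f j ^+ (m - U_(i))%MM j).
split.
  move=> _; apply/ideal_ofP; exists (fun j => (j == i)%:R).
  by rewrite (bigD1 i) //= eqxx mul1r big1 ?addr0 // => j /negPf->; rewrite mul0r.
split=> [_|]; first exact: IH.
rewrite big_ord1 {1}mE.
under eq_bigr => j _ do rewrite mnmDE exprD.
rewrite big_split /= (bigD1 i) //= mnm1E eqxx expr1 big1 ?mulr1 // => j /negPf ji.
by rewrite mnm1E eq_sym ji expr0.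
Qed.

Lemma ideal_pow_eval e (P : {mpoly R[r]}) : P \is e.-homog -> ideal_pow I e P.@[f].
Proof.
have [I0 ID IM] := ideal_pow_ideal e.
move=> Pe; rewrite mevalE big_seq; apply: (big_ind (ideal_pow I e)) => //.
by move=> m mP; apply/IM/ideal_pow_monomial/(dhomog_mf Pe mP).
Qed.

Lemma ideal_pow_evalP e x : ideal_pow I e x ->
  exists2 P : {mpoly R[r]}, P \is e.-homog & P.@[f] = x.
Proof.
elim: e x => [|e IH] x.
  by move=> _; exists x%:MP; rewrite ?mevalC // -alg_mpolyC; apply/rpredZ/dhomog1.
move=> [N [a [b [Ia [Ib ->]]]]].
have /fin_all_exists[y aE] l := proj1 (ideal_ofP _) (Ia l).
have /fin_all_exists2[P Pe PE] l := IH _ (Ib l).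
exists (\sum_(l < N) (\sum_(i < r) y l i *: 'X_i) * P l).
  apply: rpred_sum => l _; apply: (dhomogM (d := 1) (e := e)) => //.
  by apply: rpred_sum => i _; apply: rpredZ; rewrite dhomogX /= mdeg1.
rewrite rmorph_sum; apply: eq_bigr => l _; rewrite /= mevalM PE aE; congr (_ * _).
by rewrite rmorph_sum; apply: eq_bigr => i _; rewrite /= mevalZ mevalXU.
Qed.

End GeneratedIdeal.

(** * The augmented strand and its exactness *)

Section AugmentedStrand.
Variables (A : idomainType) (r s : nat).
Local Notation S := {mpoly A[r]}.
Local Notation chain := {ffun {set 'I_s} -> S}.
Variables (f : 'I_r -> A) (phi : 'M[A]_(r, s)) (m : nat).
Local Notation c := (linear_form phi).

(* The strand augmented by [A], embedded as the constants supported at the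
   empty set, so that [I^m] never has to be represented as a module. *)
Definition aug_chain (i : nat) : chain -> Prop :=
  if i is i'.+1 then strand m i' else @strand A r s 0 0.

Definition aug_diff (i : nat) (w : chain) : chain :=
  if i is _.+1 then koszul c w
  else [ffun K : {set 'I_s} => if K == set0 then ((w set0).@[f])%:MP else 0].

Hypothesis phi_syz : forall j, \sum_(i < r) phi i j * f i = 0.

Lemma aug_chain0 i : aug_chain i 0.
Proof. by case: i => [|i]; apply: strand0. Qed.

Lemma strandPl e i a (u v : chain) :
  strand e i u -> strand e i v -> strand e i (a *: u + v).
Proof.
move=> uC vC K mon ne; rewrite !ffunE mcoeffD mcoeffZ.
by rewrite (uC K mon ne) (vC K mon ne) mulr0 addr0.
Qed.

Lemma aug_chainP i a u v :
  aug_chain i u -> aug_chain i v -> aug_chain i (a *: u + v).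
Proof. by case: i => [|i]; apply: strandPl. Qed.

Lemma aug_diffP i a u v :
  aug_diff i (a *: u + v) = a *: aug_diff i u + aug_diff i v.
Proof.
case: i => [|i] /=; last exact: koszulP.
apply/ffunP=> K; rewrite !ffunE; case: ifP => _; last by rewrite scaler0 addr0.
by rewrite mevalD mevalZ mpolyCD mpolyCM mul_mpolyC.
Qed.

Lemma aug_diff_chain i w : aug_chain i.+1 w -> aug_chain i (aug_diff i w).
Proof.
case: i => [_|i]; last exact: strand_koszul.
move=> K mon; rewrite ffunE; have [->|_ _] := eqVneq K set0; last by rewrite mcoeff0.
by rewrite cards0 /= mdeg_eq0 mcoeffC => /negPf->; rewrite mulr0.
Qed.

Lemma aug_diff_diff i w : aug_chain i.+2 w -> aug_diff i (aug_diff i.+1 w) = 0.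
Proof.
case: i => [_|i _]; last exact: koszul_koszul.
apply/ffunP=> K; rewrite ffunE [RHS]ffunE; case: eqP => // _.
have -> : (koszul c w set0).@[f] = 0 by apply: koszul_eval.
exact: mpolyC0.
Qed.

(** Index [i] carries exterior degree [i - 1], so the nonzero terms stop at index [minn s m + 1], at
    most the number [n.+1] of variables. *)
Lemma aug_chain_bounded n i w : (minn s m <= n)%N -> (n.+1 < i)%N ->
  aug_chain i w -> w = 0.
Proof.
move=> bound; case: i => // i; rewrite ltnS => ni wC; apply/ffunP=> K; rewrite ffunE.
apply/mpolyP => mon; rewrite mcoeff0 wC //; apply/negP => /and3P[im /eqP Ki _].
have : (#|K| <= #|'I_s|)%N by apply: max_card.
rewrite card_ord Ki => si.
by move: bound; rewrite geq_min; lia.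
Qed.

Lemma aug_chain_coeff_map (g : A -> A) i w : g 0 = 0 ->
  aug_chain i w -> aug_chain i (coeff_map g w).
Proof.
by move=> g0; case: i => [|i] wC K mon ne; rewrite coeff_mapE // wC.
Qed.

(** For a cycle [z], this is the annihilator of its homology class. *)
Definition multiplier i z (a : A) := exists2 u, strand m i.+1 u & koszul c u = a *: z.

Lemma multiplier0 i z : multiplier i z 0.
Proof. by exists 0; [exact: strand0 | rewrite koszul0 scale0r]. Qed.

Lemma multiplierD i z a b :
  multiplier i z a -> multiplier i z b -> multiplier i z (a + b).
Proof.
move=> [u uC ua] [v vC vb]; exists (1 *: u + v); first exact: strandPl.
by rewrite koszulP scale1r ua vb scalerDl.
Qed.

Lemma multiplierM i z a b : multiplier i z b -> multiplier i z (a * b).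
Proof.
move=> [u uC ub]; exists (a *: u + 0); first exact/strandPl/strand0.
by rewrite koszulP koszul0 addr0 ub scalerA.
Qed.

Lemma loc_multiplier (F : fieldType) (pi : {rmorphism A -> F}) i z :
  loc_exact c (loc_unit pi) setT ->
  (forall P : S, P \is m.-homog -> P.@[f] = 0 -> loc_span c (loc_unit pi) setT P) ->
  (i <= m)%N -> aug_chain i.+1 z -> aug_diff i z = 0 ->
  exists2 a, loc_unit pi a & multiplier i z a.
Proof.
move=> exK rees im zC dz.
suff [a La [u ua]] : exists2 a, loc_unit pi a & exists u, koszul c u = a *: z.
  by exists a => //; apply: (strand_boundary im zC ua).
have zP := (strandP z im).1 zC.
case: i zC dz im zP => [|i] zC dz im zP.
  have [a La aP] : loc_span c (loc_unit pi) setT (z set0).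
    apply: rees; first by have [_] := zP set0; rewrite subn0.
    have := congr1 (fun w : chain => w set0) dz; rewrite !ffunE eqxx => /eqP.
    by rewrite mpolyC_eq0 => /eqP.
  have [u [_ _ du]] := span_boundary aP.
  exists a => //; exists u; rewrite du; apply/ffunP=> K; rewrite !ffunE.
  have [->//|K0] := eqVneq K set0.
  by rewrite (proj1 (zP K)) ?cards_eq0 ?scaler0.
have [||//|a [u [La _ _ ua]]] := exK i z; last by exists a => //; exists u.
- by move=> K; rewrite subsetT.
- by move=> K Ki; apply: (proj1 (zP K)).
Qed.

End AugmentedStrand.

Section StrandExactness.
Variables (n : nat) (k : closedFieldType) (r s : nat).
Local Notation R := {mpoly k[n.+1]}.
Local Notation S := {mpoly R[r]}.
Variables (f : 'I_r -> R) (phi : 'M[R]_(r, s)) (m : nat).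
Local Notation c := (linear_form phi).
Local Notation chain := {ffun {set 'I_s} -> S}.
Local Notation aug_chain := (@aug_chain R r s m).
Local Notation aug_diff := (@aug_diff R r s f phi).

Definition variable (l : nat) : R := 'X_(inord l).

Hypothesis phi_syz : forall j, \sum_(i < r) phi i j * f i = 0.
Hypothesis bound : (minn s m <= n)%N.

Local Notation D := (first_multiples variable aug_chain).

(** Divisibility by a set of variables is read on the monomials free of them; the regularity of the
    variables then follows by shifting exponents. *)
Lemma first_multiplesP l i w : (l <= n.+1)%N -> D l i w <-> aug_chain i w /\
  forall (K : {set 'I_s}) (mon : 'X_{1..r}) (mm : 'X_{1..n.+1}),
    (forall t : 'I_n.+1, (t < l)%N -> mm t = 0%N) -> ((w K)@_mon)@_mm = 0.
Proof.
elim: l w => [|l IH] w ln.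
  split=> [->|[_ w0]].
    by split=> [|*]; rewrite ?ffunE ?mcoeff0 //; exact: aug_chain0.
  by apply/ffunP=> K; rewrite ffunE; apply/mpolyP=> mon; rewrite mcoeff0;
     apply/mpolyP=> mm; rewrite mcoeff0 w0.
split=> [[u [v [uC Dv ->]]]|[wC w0]].
  have [vC v0] := (IH _ (ltnW ln)).1 Dv.
  split=> [|K mon mm mmt]; first exact: aug_chainP.
  rewrite !ffunE mcoeffD mcoeffZ mcoeffD v0 ?addr0; last by move=> t tl; apply/mmt/leqW.
  by apply/mcoeff_varM/mmt; rewrite inordK.
pose x : 'I_n.+1 := inord l.
exists (coeff_map (var_quo x) w), (coeff_map (var_rem x) w).
have q0 : var_quo x (0 : R) = 0 by apply: var_quo0.
have r0 : var_rem x (0 : R) = 0 by apply: var_rem0.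
split; first exact: aug_chain_coeff_map.
  apply/(IH _ (ltnW ln)); split=> [|K mon mm mmt]; first exact: aug_chain_coeff_map.
  rewrite coeff_mapE // mcoeff_var_rem; case: eqP => // mx; apply: w0 => t.
  rewrite ltnS leq_eqVlt => /orP[/eqP tl|/mmt//].
  by rewrite -mx; congr (mm _); apply: val_inj; rewrite /= inordK.
apply/ffunP=> K; rewrite !ffunE; apply/mpolyP => mon.
have qE := coeff_mapE w K mon q0; have rE := coeff_mapE w K mon r0.
rewrite !ffunE in qE rE; rewrite mcoeffD mcoeffZ qE rE; exact: var_divE.
Qed.

Lemma aug_chain_regular l i u :
  (l < n.+1)%N -> aug_chain i u -> D l i (variable l *: u) -> D l i u.
Proof.
move=> ln uC /(first_multiplesP _ _ (ltnW ln))[_ u0].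
apply/(first_multiplesP _ _ (ltnW ln)); split=> // K mon mm mmt.
have := u0 K mon (mm + U_(inord l))%MM; rewrite ffunE mcoeffZ mcoeff_varM_add; apply.
move=> t tl; rewrite mnmDE mnm1E mmt //; case: eqP => // E.
by move: tl; rewrite -E inordK // ltnn.
Qed.

Hypothesis local_data : forall p : R -> Prop, is_prime p ->
  ~ (forall x, p x <-> maxm x) ->
  exists (F : fieldType) (pi : {rmorphism R -> F}),
  [/\ forall x, pi x = 0 <-> p x,
      loc_exact c (loc_unit pi) setT &
      forall P : S, P \is m.-homog -> P.@[f] = 0 ->
        loc_span c (loc_unit pi) setT P].

(** If the annihilator of the class of [z] contained no power of the variable, some prime would
    contain it and avoid the variable. Such a prime is not the irrelevant ideal, so [local_data]
    gives a multiplier outside it, a contradiction. *)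
Lemma aug_torsion i z l : aug_chain i.+1 z -> aug_diff i z = 0 ->
  (l < n.+1)%N ->
  exists e u, aug_chain i.+2 u /\ variable l ^+ e *: z = aug_diff i.+1 u.
Proof.
move=> zC dz ln.
have [mi|im] := ltnP m i.
  exists 0%N, 0; split; first exact: strand0.
  by rewrite (strand_gt mi zC) [RHS]koszul0 scaler0.
have Jideal : is_ideal (multiplier phi m i z).
  split; [exact: multiplier0|exact: multiplierD|exact: multiplierM].
apply: boolp.contrapT => nJ.
have [e [u uC ue]|p [pp Jp px]] := prime_avoiding_powers (x := variable l) Jideal.
  by apply: nJ; exists e, u; split; [apply: uC | apply: (esym ue)].
have [|F [pi [piP exK rees]]] := local_data pp.
  by move=> /(_ (variable l)) [_ H]; apply/px/H; rewrite /maxm /variable mcoeffX mnm1_eq0.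
have [a La Ja] := loc_multiplier exK rees im zC dz.
by move: La; rewrite /loc_unit => /eqP; apply; apply/piP/Jp.
Qed.

Lemma strand_exact i z : aug_chain i.+1 z -> aug_diff i z = 0 ->
  exists2 u, strand m i.+1 u & z = koszul c u.
Proof.
apply: (@acyclicity R _ n.+1 variable aug_diff aug_chain).
- exact: aug_chain0.
- exact (@aug_chainP R r s m).
- exact (@aug_diffP R r s f phi).
- exact: aug_diff_chain.
- exact: aug_diff_diff.
- by move=> {}i w; apply: aug_chain_bounded.
- exact: aug_chain_regular.
- exact: aug_torsion.
Qed.

End StrandExactness.

(** * Local complete intersections supply the local hypotheses *)

Section UnimodularColumns.
Variables (A : idomainType) (F : fieldType) (pi : {rmorphism A -> F}).
Variables (r s : nat) (phi : 'M[A]_(r, s)).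

Lemma unimodular_columns : (s < r)%N -> (r <= 2 + \rank (map_mx pi phi))%N ->
  exists (B : {set 'I_s}) (X : 'M[A]_(s, r)) (d : A),
  [/\ loc_unit pi d, (s.-1 <= #|B|)%N &
    forall j l, j \in B -> l \in B -> (X *m phi) j l = d *+ (j == l)].
Proof.
move=> sr rk; have [B [X [d [cB Ld Xphi]]]] := unit_minor pi phi.
rewrite -cB in rk.
by exists B, X, d; split=> //; lia.
Qed.
End UnimodularColumns.

Section LocalData.
Variables (n : nat) (k : closedFieldType) (r s : nat).
Local Notation R := {mpoly k[n.+1]}.
Local Notation S := {mpoly R[r]}.
Variables (f : 'I_r -> R) (phi : 'M[R]_(r, s)).
Local Notation c := (linear_form phi).
Local Notation I := (ideal_of [seq f i | i : 'I_r]).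
Hypothesis phi_inj : forall h : 'I_s -> R,
  (forall i, \sum_(j < s) phi i j * h j = 0) -> forall j, h j = 0.
Hypothesis phi_syz : forall j, \sum_(i < r) phi i j * f i = 0.
Hypothesis syz_phi : forall g : 'I_r -> R, \sum_(i < r) g i * f i = 0 ->
  exists h : 'I_s -> R, forall i, g i = \sum_(j < s) phi i j * h j.
Hypothesis heightI : ideal_height I 2.
Hypothesis lciI : local_complete_intersection I.

(** Otherwise [I = 0] and the zero ideal is a prime over [I], where no strict chain of length two
    can end. *)
Lemma height2_gen_neq0 : exists i, f i != 0.
Proof.
apply: boolp.contrapT => nf.
have f0 i : f i = 0 by apply/eqP/negPn/negP => fi; apply: nf; exists i.
have [|x /ideal_ofP[g ->]|P [[Pp Pc] P2]] := heightI.1 (fun x => x = 0).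
- split; first (split=> //).
  + by move=> x y -> ->; rewrite addr0.
  + by move=> a x ->; rewrite mulr0.
  + by move/eqP; rewrite oner_eq0.
  + by move=> x y /eqP; rewrite mulf_eq0 => /orP[]/eqP; [left|right].
- by rewrite big1 // => i _; rewrite f0 mulr0.
have [P01 [x [P1x P0x]]] := Pc 0%N isT; have [P12 _] := Pc 1%N isT.
apply: P0x; have /P2 -> := P12 _ P1x.
by have [[] ] := Pp 0%N isT.
Qed.

Lemma gens_lt : (s < r)%N.
Proof.
by have [i fi] := height2_gen_neq0; apply: (syzygy_rank_lt phi_inj phi_syz fi).
Qed.

Lemma local_data p : is_prime p -> ~ (forall x, p x <-> maxm x) ->
  exists (F : fieldType) (pi : {rmorphism R -> F}),
  [/\ forall x, pi x = 0 <-> p x,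
      loc_exact c (loc_unit pi) setT &
      forall e (P : S), P \is e.+1.-homog -> P.@[f] = 0 ->
        loc_span c (loc_unit pi) setT P].
Proof.
move=> pp pm; have [[p0 pD pM] p1 pprime] := pp.
have [F [pi piP]] := residue_field p0 pD pM p1 pprime.
exists F, pi; have sr := gens_lt.
have unitP a : ~ p a -> loc_unit pi a by move=> pa; apply/eqP => /piP.
(* If [p] does not contain [I], some [f i] is a unit at [p] and generates [I_p] alone: [q = 1]. *)
have [Ip|nIp] := boolp.pselect (subI I p); last first.
  have [i pf] : exists i, ~ p (f i).
    apply: boolp.contrapT => nf; apply: nIp => x /ideal_ofP[g ->].
    apply: (big_ind p) => // i _; apply: pM; apply: boolp.contrapT => pf.
    by apply: nf; exists i.
  have rk : (r <= 1 + \rank (map_mx pi phi))%N.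
    apply: (rank_loc syz_phi (U := \col_a f a) (V := delta_mx 0 i) (t := f i)).
      exact: unitP.
    move=> a; rewrite (bigD1 i) //= big1 ?addr0 => [|j /negPf ji];
      rewrite mxE big_ord1 !mxE ?eqxx ?ji ?mulr1 ?mulr0 ?mul0r //.
    exact: mulrC.
  have [B [X [d [Ld cB Xphi]]]] := unimodular_columns sr (leq_trans rk (leqnSn _)).
  split=> //; first exact: koszul_loc_exact Ld Xphi phi_inj cB.
  by move=> e P Pe; apply: (rees_loc_unit syz_phi (unitP _ pf) Pe).
have [gs [szgs [gsI [Igs [reg _]]]]] := lciI heightI pp Ip pm.
case: gs szgs gsI Igs reg => [//|h1 [//|h2 [|//]]] _ gsI Igs reg.
have [t1 [pt1 /ideal_ofP[y1 E1]]] : in_loc p I h1 by apply: gsI; rewrite inE eqxx.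
have [t2 [pt2 /ideal_ofP[y2 E2]]] : in_loc p I h2.
  by apply: gsI; rewrite !inE eqxx orbT.
(* If [h1] were zero, regularity of the first element would put [1] in the localized zero ideal. *)
have h10 : h1 != 0.
  apply/eqP => h10; have [||t [pt [cs]]] := reg 0%N _ 1; first by [].
    by exists 1; split=> //; exists [::]; rewrite /= big_ord0 h10 mul0r mulr0.
  by rewrite /= big_ord0 mulr1 => t0; apply: pt; rewrite t0.
have h12 a b : h2 * a = h1 * b ->
    exists2 t, loc_unit pi t & exists e, t * a = h1 * e.
  move=> hab; have [||t [pt [cs]]] := reg 1%N _ a; first by [].
    by exists 1; split=> //; exists [:: b]; rewrite /= big_ord1 /= mul1r hab mulrC.
  rewrite /= big_ord1 /= => E; exists t; first exact: unitP.
  by exists cs`_0; rewrite E mulrC.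
have /fin_all_exists[T TP] i : exists q : R * R * R, ~ p q.1.1 /\
    q.1.1 * f i = q.1.2 * h1 + q.2 * h2.
  have If : I (f i).
    apply/ideal_ofP; exists (fun j => (j == i)%:R).
    by rewrite (bigD1 i) //= eqxx mul1r big1 ?addr0 // => j /negPf->; rewrite mul0r.
  have [t [pt [cs E]]] := Igs _ If; exists (t, cs`_0, cs`_1); split=> //=.
  by rewrite E /= big_ord_recl big_ord1.
pose rest i := \prod_(j < r | j != i) (T j).1.1.
(* A common denominator: the [T j] express the generators through [h1], [h2], and [t1], [t2] express
   these through the generators, so [t f] factors through two columns. *)
pose t := (\prod_(j < r) (T j).1.1) * (t1 * t2).
have Lt : loc_unit pi t.
  apply: loc_unitM; last by apply: loc_unitM; apply: unitP.
  rewrite /loc_unit rmorph_prod; apply/prodf_neq0 => i _.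
  by apply: unitP; have [] := TP i.
have rk : (r <= 2 + \rank (map_mx pi phi))%N.
  apply: (rank_loc syz_phi Lt
    (U := row_mx (\col_a (rest a * (T a).1.2 * t2)) (\col_a (rest a * (T a).2 * t1)))
    (V := col_mx (\row_b y1 b) (\row_b y2 b)) (q := 1 + 1)).
  move=> i; rewrite mul_row_col.
  have -> : t * f i = rest i * (T i).1.2 * t2 * (t1 * h1)
                    + rest i * (T i).2 * t1 * (t2 * h2).
    have [_ TE] := TP i; rewrite /t (bigD1 i) //= -/(rest i).
    transitivity (rest i * t1 * t2 * ((T i).1.1 * f i)); first by ring.
    by rewrite TE; ring.
  rewrite E1 E2 !mulr_sumr -big_split /=; apply: eq_bigr => j _.
  by rewrite !mxE !big_ord1 !mxE; ring.
have [B [X [d [Ld cB Xphi]]]] := unimodular_columns sr rk.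
split=> //; first exact: koszul_loc_exact Ld Xphi phi_inj cB.
move=> e P Pe Pf.
apply: (loc_span_depth2_exp Ld Xphi phi_inj cB h10 h12 Pe).
  exact: (rees_loc_multiple syz_phi (unitP _ pt1) E1 Pe Pf).
exact: (rees_loc_multiple syz_phi (unitP _ pt2) E2 Pe Pf).
Qed.

End LocalData.

(** * Minimality *)

Section Minimality.
Variables (A : idomainType) (r s : nat) (phi : 'M[A]_(r, s)) (M : A -> Prop).
Local Notation S := {mpoly A[r]}.
Local Notation c := (linear_form phi).
Hypothesis M0 : M 0.
Hypothesis MD : forall x y, M x -> M y -> M (x + y).
Hypothesis MM : forall a x, M x -> M (a * x).
Hypothesis Mphi : forall i j, M (phi i j).

Lemma linear_formM_coeff j (Q : S) mon : M (c j * Q)@_mon.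
Proof.
rewrite mulr_suml raddf_sum; apply: (big_ind M) => // i _ /=.
by rewrite -scalerAl mcoeffZ mulrC; apply: MM.
Qed.

Lemma koszul_coeff (w : {ffun {set 'I_s} -> S}) K mon : M (koszul c w K)@_mon.
Proof.
rewrite ffunE raddf_sum; apply: (big_ind M) => // j _ /=.
by rewrite mulrAC mulrC; apply: linear_formM_coeff.
Qed.

End Minimality.

(** * Transfer to [kdiff], and the theorem *)

Section MpolyKoszul.
Variables (A : idomainType) (r s : nat) (phi : 'M[A]_(r, s)).
Local Notation S := {mpoly A[r]}.
Local Notation chain := {ffun {set 'I_s} -> S}.

(* [koszul] for the ring structure that [{mpoly A[r]}] carries by itself: it
   mediates the conversion between [koszul] and [kdiff]. *)
Definition koszul_mpoly (w : chain) : chain := [ffun K : {set 'I_s} =>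
  \sum_(j < s | j \notin K)
    (-1) ^+ #|[set x in K | (x < j)%N]| * linear_form phi j * w (j |: K)].

Lemma koszul_mpolyE w : koszul (linear_form phi) w = koszul_mpoly w.
Proof. by []. Qed.

Lemma koszul_mpoly_set0 w :
  koszul_mpoly w set0 = \sum_(j < s) linear_form phi j * w [set j].
Proof. by rewrite -koszul_mpolyE koszul_set0. Qed.
End MpolyKoszul.

Section KdiffConversion.
Variables (n : nat) (k : closedFieldType) (r s : nat).
Local Notation R := {mpoly k[n.+1]}.
Local Notation S := {mpoly R[r]}.
Variable (phi : 'M[R]_(r, s)).

Lemma kdiffE w : kdiff phi w = koszul (linear_form phi) w.
Proof.
by rewrite koszul_mpolyE; reflexivity.
Qed.

Lemma kdiff_set0 w :
  kdiff phi w set0 = \sum_(j < s) cvec phi j * w [set j].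
Proof.
transitivity (koszul_mpoly phi w set0); first by rewrite kdiffE koszul_mpolyE.
by rewrite koszul_mpoly_set0; reflexivity.
Qed.

Lemma kdiff_eval (f : 'I_r -> R) w :
  (forall j, \sum_(i < r) phi i j * f i = 0) -> evalf f (kdiff phi w set0) = 0.
Proof. by move=> fs; rewrite kdiffE; apply: koszul_eval. Qed.

Lemma kdiff_strand m i w : strand m i.+1 w -> strand m i (kdiff phi w).
Proof. by rewrite kdiffE; apply: strand_koszul. Qed.

Lemma kdiff_kdiff w : kdiff phi (kdiff phi w) = 0.
Proof. by rewrite !kdiffE; apply: koszul_koszul. Qed.

Lemma kdiff_0 : kdiff phi 0 = 0.
Proof. by rewrite kdiffE; apply: koszul0. Qed.

Lemma inCP m i (w : {ffun {set 'I_s} -> S}) : (i <= m)%N -> strand m i w <-> inC m i w.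
Proof. exact: strandP. Qed.

Lemma maxm_ideal : is_ideal (@maxm n k).
Proof.
rewrite /maxm; split.
- by rewrite mcoeff0.
- by move=> x y; rewrite mcoeffD => -> ->; rewrite addr0.
- move=> a x; change ((a * x)@_0) with (mcoeff 0%MM (a * x)).
  by rewrite rmorphM /= => ->; rewrite mulr0.
Qed.

Lemma kdiff_coeff w K mon :
  (forall i j, maxm (phi i j)) -> maxm (kdiff phi w K)@_mon.
Proof.
have [M0 MD MM] := maxm_ideal; move=> phim; rewrite kdiffE.
exact: (koszul_coeff M0 MD MM phim).
Qed.
End KdiffConversion.

Section KdiffExactness.
Variables (n : nat) (k : closedFieldType) (r s : nat).
Local Notation R := {mpoly k[n.+1]}.
Local Notation S := {mpoly R[r]}.
Local Notation chain := {ffun {set 'I_s} -> S}.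
Variables (f : 'I_r -> R) (phi : 'M[R]_(r, s)) (m : nat).
Local Notation I := (ideal_of [seq f i | i : 'I_r]).
Hypothesis phi_inj : forall h : 'I_s -> R,
  (forall i, \sum_(j < s) phi i j * h j = 0) -> forall j, h j = 0.
Hypothesis phi_syz : forall j, \sum_(i < r) phi i j * f i = 0.
Hypothesis syz_phi : forall g : 'I_r -> R, \sum_(i < r) g i * f i = 0 ->
  exists h : 'I_s -> R, forall i, g i = \sum_(j < s) phi i j * h j.
Hypothesis heightI : ideal_height I 2.
Hypothesis lciI : local_complete_intersection I.
Hypothesis m_gt0 : (0 < m)%N.
Hypothesis bound : (minn r.-1 m <= n)%N.

Lemma kdiff_exact i (z : chain) : (i <= m)%N -> inC m i z ->
  (if i == 0%N then evalf f (z set0) = 0 else kdiff phi z = 0) ->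
  exists2 u, strand m i.+1 u & z = kdiff phi u.
Proof.
move=> im /(inCP z im) zC dz.
have sr : (s < r)%N := gens_lt phi_inj phi_syz heightI.
(* [s < r] gives [s <= r.-1], so the numerical hypothesis bounds the length of the strand. *)
have smn : (minn s m <= n)%N by move: bound; rewrite !geq_min; lia.
have ldata : forall p : R -> Prop, is_prime p ->
    ~ (forall x, p x <-> maxm x) ->
    exists (F : fieldType) (pi : {rmorphism R -> F}),
    [/\ forall x, pi x = 0 <-> p x,
      loc_exact (linear_form phi) (loc_unit pi) setT &
      forall P : S, P \is m.-homog -> P.@[f] = 0 ->
        loc_span (linear_form phi) (loc_unit pi) setT P].
  move=> p pp pm.
  have [F [pi [piP exK rees]]] :=
    local_data phi_inj phi_syz syz_phi heightI lciI pp pm.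
  by exists F, pi; split=> // P Pm; apply: (rees m.-1); rewrite prednK.
have [|u uC ->] := strand_exact phi_syz smn ldata (i := i) zC; last first.
  by exists u; [apply: uC | apply: (esym (kdiffE phi u))].
case: i dz {im zC} => [|i] dz; last by rewrite /aug_diff -kdiffE.
apply/ffunP=> K; rewrite ffunE [RHS]ffunE; case: ifP => // _.
by rewrite -[_.@[f]]/(evalf f (z set0)) dz; apply: mpolyC0.
Qed.

Lemma inC_set0 (P : S) : P \is m.-homog ->
  inC m 0 [ffun K : {set 'I_s} => if K == set0 then P else 0].
Proof.
move=> Pm K; rewrite ffunE subn0; split; first by rewrite cards_eq0 => /negPf->.
by case: ifP => // _; apply: rpred0.
Qed.

Lemma kdiff_exact0 (P : S) : P \is m.-homog -> evalf f P = 0 ->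
  exists2 u, strand m 1 u & P = kdiff phi u set0.
Proof.
move=> Pm Pf; have [|u uC zu] := kdiff_exact (leq0n m) (inC_set0 Pm).
  by rewrite /= ffunE eqxx.
by exists u; [apply: uC | rewrite -zu ffunE eqxx].
Qed.

End KdiffExactness.

Theorem theorem2p5
  (n : nat) (k : closedFieldType) (char0 : [pchar k] =i pred0)
  (r s : nat)
  (f : 'I_r -> {mpoly k[n.+1]})           (* e_i |-> f_i *)
  (phi : 'M[{mpoly k[n.+1]}]_(r, s))       (* phi(u_j) = sum_i phi_ij e_i *)
  (a : 'I_r -> nat) (b : 'I_s -> nat)      (* deg e_i = a i, deg u_j = b j *)
  (m : nat) :
  let I := ideal_of [seq f i | i : 'I_r] in
  (* graded: f_i homogeneous of degree a i, phi homogeneous of degree 0 *)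
  (forall i, f i \is (a i).-homog) ->
  (forall i j, phi i j != 0 -> (a i <= b j)%N) ->
  (forall i j, phi i j \is (b j - a i).-homog) ->
  (* minimality: the f_i are minimal generators, entries of phi lie in m *)
  (forall i, ~ ideal_of [seq f i' | i' <- enum 'I_r & i' != i] (f i)) ->
  (forall i j, maxm (phi i j)) ->
  (* exactness of 0 -> F -> G -> I -> 0 *)
  (forall h : 'I_s -> {mpoly k[n.+1]},
      (forall i, \sum_(j < s) phi i j * h j = 0) -> forall j, h j = 0) ->
  (forall j, \sum_(i < r) phi i j * f i = 0) ->
  (forall g : 'I_r -> {mpoly k[n.+1]}, \sum_(i < r) g i * f i = 0 ->
      exists h : 'I_s -> {mpoly k[n.+1]},
        forall i, g i = \sum_(j < s) phi i j * h j) ->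
  (* I perfect of codimension two, local complete intersection *)
  perfect I -> ideal_height I 2 -> local_complete_intersection I ->
  (0 < m)%N -> (minn r.-1 m <= n)%N ->
  (* Sym^m I -> I^m is an isomorphism, with Sym^m I = Sym^m G / (c_1..c_s) Sym^{m-1} G *)
  ((forall x, ideal_pow I m x ->
      exists P : {mpoly {mpoly k[n.+1]}[r]}, P \is m.-homog /\ evalf f P = x) /\
   (forall P : {mpoly {mpoly k[n.+1]}[r]}, P \is m.-homog -> evalf f P = 0 ->
      exists Q : 'I_s -> {mpoly {mpoly k[n.+1]}[r]},
        (forall j, Q j \is m.-1.-homog) /\ P = \sum_(j < s) cvec phi j * Q j))
  /\
  (* the complex 0 -> /\^m F -> ... -> Sym^m G -> I^m -> 0 is a resolution *)
  ( (* it is a complex *)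
    (forall P : {mpoly {mpoly k[n.+1]}[r]}, P \is m.-homog -> ideal_pow I m (evalf f P)) /\
    (forall i w, (i <= m)%N -> inC m i w -> inC m i.-1 (kdiff phi w)) /\
    (forall w, inC m 1 w -> evalf f (kdiff phi w set0) = 0) /\
    (forall i w, inC m i w -> kdiff phi (kdiff phi w) = 0) /\
    (* exact at I^m *)
    (forall x, ideal_pow I m x ->
      exists w : {ffun {set 'I_s} -> {mpoly {mpoly k[n.+1]}[r]}}, inC m 0 w /\ evalf f (w set0) = x) /\
    (* exact at Sym^m G (i = 0) and at /\^i F (x) Sym^{m-i} G, 0 < i < m *)
    (forall i, (i < m)%N -> forall w, inC m i w ->
       (if i == 0%N then evalf f (w set0) = 0 else kdiff phi w = 0) ->
       exists v, inC m i.+1 v /\ kdiff phi v = w) /\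
    (* exact at /\^m F *)
    (forall w, inC m m w -> kdiff phi w = 0 -> w = 0) /\
    (* minimal: all differentials have entries in m *)
    (forall i, (0 < i <= m)%N -> forall w, inC m i w ->
       forall J mon, maxm ((kdiff phi w J)@_mon)) /\
    (forall P : {mpoly {mpoly k[n.+1]}[r]}, P \is m.-homog -> evalf f P = 0 ->
       forall mon, maxm (P@_mon))).
Proof.
move=> I _ _ _ _ phi_min phi_inj phi_syz syz_phi _ heightI lciI m_gt0 bound.
have exact_at := kdiff_exact phi_inj phi_syz syz_phi heightI lciI m_gt0 bound.
have exact0 := kdiff_exact0 phi_inj phi_syz syz_phi heightI lciI m_gt0 bound.
have surj x : ideal_pow I m x ->
    exists P : {mpoly {mpoly k[n.+1]}[r]}, P \is m.-homog /\ evalf f P = x.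
  by move=> /ideal_pow_evalP[P Pm Pf]; exists P.
split; first split=> //.
  move=> P Pm Pf; have [u uC ->] := exact0 P Pm Pf.
  exists (fun j => u [set j]); split; last exact: kdiff_set0.
  by move=> j; rewrite -subn1; have [_] := (inCP u m_gt0).1 uC [set j].
split; first by move=> P; apply: ideal_pow_eval.
split.
  move=> [|i] w im wC; last first.
    by apply/(inCP _ (ltnW im))/kdiff_strand/(inCP w im).
  (* At [i = 0] the predecessor is again [0], and a chain of exterior degree zero has zero
     differential. *)
  suff -> : kdiff phi w = 0 by apply/(inCP 0 (leq0n m)); apply: strand0.
  apply/ffunP=> K; rewrite [LHS]ffunE [RHS]ffunE big1 // => j jK.
  by rewrite (proj1 (wC (j |: K))) ?mulr0 // cardsU1 jK.
split; first by move=> w _; apply: kdiff_eval.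
split; first by move=> i w _; apply: kdiff_kdiff.
split.
  move=> x /surj[P [Pm Pf]].
  exists [ffun K : {set 'I_s} => if K == set0 then P else 0].
  by split; [apply: inC_set0 | rewrite ffunE eqxx].
split.
  move=> i im w wC w0; have [u uC wu] := exact_at i w (ltnW im) wC w0.
  by exists u; split; [apply/(inCP u im) | rewrite wu].
split.
  move=> w wC w0; have [|u uC ->] := exact_at m w (leqnn m) wC.
    by rewrite eqn0Ngt m_gt0.
  (* The primitive has exterior degree [m.+1], where the strand is zero. *)
  by rewrite (strand_gt _ uC) // kdiff_0.
split; first by move=> i _ w _ J mon; apply: kdiff_coeff.
(* The kernel of [Sym^m G -> I^m] consists of boundaries, whose coefficients lie in [maxm]. *)
by move=> P Pm Pf mon; have [u uC ->] := exact0 P Pm Pf; apply: kdiff_coeff.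
Qed.
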